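(* Let $f=\frac1n\sum_{i=1}^n f_i:\mathbb{R}^d\to\mathbb{R}$ be convex, $\mu$-quasi strongly convex with $\mu\ge0$ (with unique minimizer $x^*$) and $L$-smooth. Consider EC-SGD with an absolute compression operator with constant $\Delta\ge0$, and suppose that the Key Parametric Assumption holds with parameters $A,B,C,D_1,D_2\ge0$, $\rho\in(0,1]$ and a sequence $\{\sigma_k^2\}_{k\ge0}$. Let $F=\frac{4B}{3\rho}$, $R_0=\|x^0-x^*\|$ and $\hat T_0=R_0^2+\frac{F}{16(A+CF)^2}\sigma_0^2$. Then for every $K\ge1$ there exists a choice of the stepsize $0<\gamma\le\frac{1}{4(A+CF)}$ (possibly depending on $K$) such that, with $\eta=\min\{\frac{\gamma\mu}{2},\frac{\rho}{4}\}$, $w_k=(1-\eta)^{-(k+1)}$, $W_K=\sum_{k=0}^Kw_k$ and $\overline{x}^K=\frac1{W_K}\sum_{k=0}^Kw_kx^k$, the quantity $\mathbb{E}[f(\overline{x}^K)-f(x^* )]$ is of the order $$\widetilde{\mathcal{O}}\left((A+CF)\,\mathbb{E}[\hat T_0]\exp\left(-\min\left\{\frac{\mu}{A+CF},\rho\right\}K\right)+\frac{D_1+FD_2}{\mu K}+\frac{L\Delta^2}{\mu^2K^2}\right)\quad\text{when }\mu>0,$$ $$\mathcal{O}\left(\frac{(A+CF)R_0^2}{K}+\frac{R_0\sqrt{B\,\mathbb{E}[\sigma_0^2]}}{K\sqrt{\rho}}+\sqrt{\frac{R_0^2(D_1+FD_2)}{K}}+\frac{L^{1/3}R_0^{4/3}\Delta^{2/3}}{K^{2/3}}\right)\quad\text{when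 }\mu=0.$$
   Context: Problem: minimize $f(x)=\frac1n\sum_{i=1}^n f_i(x)$ over $x\in\mathbb{R}^d$, where $f_1,\dots,f_n:\mathbb{R}^d\to\mathbb{R}$ are differentiable; the minimizer $x^*$ of $f$ is unique. $f$ is $\mu$-quasi strongly convex ($\mu\ge0$) if $f(x^* )\ge f(x)+\langle\nabla f(x),x^*-x\rangle+\frac{\mu}{2}\|x-x^*\|^2$ for all $x\in\mathbb{R}^d$. $f$ is $L$-smooth if $\|\nabla f(x)-\nabla f(y)\|\le L\|x-y\|$ for all $x,y\in\mathbb{R}^d$. Absolute compression operator: a (possibly stochastic) map $\mathcal{C}:\mathbb{R}^d\to\mathbb{R}^d$ for which there is $\Delta\ge0$ with $\mathbb{E}[\|\mathcal{C}(x)-x\|^2]\le\Delta^2$ for all $x\in\mathbb{R}^d$. If $\mathcal{C}$ is stochastic, each application uses fresh randomness, so the bound holds conditionally on the argument. EC-SGD: given $x^0\in\mathbb{R}^d$ and stepsize $\gamma>0$, set $e_i^0=0$ for $i=1,\dots,n$. For $k=0,1,2,\dots$, each worker $i$ computes a stochastic gradient $g_i^k$, sets $v_i^k=\gamma\,\mathcal{C}\!\left(\frac{e_i^k+\gamma g_i^k}{\gamma}\right)$ and $e_i^{k+1}=e_i^k+\gamma g_i^k-v_i^k$; then $x^{k+1}=x^k-v^k$ with $v^k=\frac1n\sum_{i=1}^n v_i^k$. Key Parametric Assumption: let $g^k=\frac1n\sum_{i=1}^n g_i^k$ and let $\mathbb{E}_k[\cdot]$ denote expectation with respect to the randomness coming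 from iteration $k$ (i.e. conditional on everything before iteration $k$). For all $k\ge0$, $\mathbb{E}_k[g^k]=\nabla f(x^k)$. Moreover there exist $A,B,C,D_1,D_2\ge0$, $\rho\in(0,1]$ and a sequence of (possibly random) variables $\{\sigma_k^2\}_{k\ge0}$ (nonnegative) such that for all $k\ge0$ $$\mathbb{E}_k[\|g^k\|^2]\le 2A(f(x^k)-f(x^* ))+B\sigma_k^2+D_1,$$ $$\mathbb{E}_k[\sigma_{k+1}^2]\le(1-\rho)\sigma_k^2+2C(f(x^k)-f(x^* ))+D_2.$$ The parameters do not depend on the stepsize $\gamma$. It is assumed that $A+CF>0$, so that the expressions in the claim are defined. Order notation: $\mathcal{O}(\cdot)$ hides an absolute numerical constant. $\widetilde{\mathcal{O}}(\cdot)$ hides absolute numerical constants (including a positive absolute constant factor in the exponent) and factors polynomial in logarithms of $K$ and of the problem parameters.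
   Formalization: For μ=0 the bound is stated only for x⁰≠x* (if x⁰=x* its right side is 0 and gradient noise makes it false); the Key Parametric Assumption is taken for the run with every stepsize γ>0, with stochastic gradients that depend on the iterates and randomness but are not given γ. *)

(* Defs.v *)
(* MathComp + MathComp-Analysis *)
From HB Require Import structures.
From mathcomp Require Export all_boot all_order all_algebra.
From mathcomp Require Export all_classical all_reals all_analysis.
Export Order.TTheory GRing.Theory Num.Theory.
Export numFieldNormedType.Exports.

Set Implicit Arguments.
Unset Strict Implicit.
Unset Printing Implicit Defensive.

Local Open Scope classical_set_scope.
Local Open Scope ring_scope.

Section Euclidean.
Context {R : realType} {d : nat}.
Local Notation V := 'rV[R]_d.
Implicit Types (f : V -> R) (u v x y : V).

Definition dot u v : R := \sum_(j < d) u 0 j * v 0 j.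

(* The norm that the library puts on row vectors is the sup norm. *)
Definition enorm u : R := Num.sqrt (dot u u).

Definition grad f x : V := \row_(j < d) 'D_(delta_mx 0 j) f x.

Definition quasi_strongly_convex (mu : R) (xs : V) f : Prop :=
  forall x,
    f x + dot (grad f x) (xs - x) + mu / 2 * enorm (x - xs) ^+ 2 <= f xs.

Definition smooth (L : R) f : Prop :=
  forall x y, enorm (grad f x - grad f y) <= L * enorm (x - y).

Definition unique_minimizer f (xs : V) : Prop :=
  forall x, x != xs -> f xs < f x.

Definition average (n : nat) (fs : 'I_n -> V -> R) : V -> R :=
  fun x => n%:R^-1 * \sum_(i < n) fs i x.

End Euclidean.

Section Probability.
Context {R : realType} {dO : measure_display} {Omega : measurableType dO}.
Variable P : probability Omega R.
Implicit Types (F G : set (set Omega)) (X Y : Omega -> R).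

Definition sub_sigma_field G : Prop :=
  sigma_algebra setT G /\ G `<=` measurable.

(* Borel measurability with respect to a sub-sigma-field *)
Definition measurable_wrt {T : topologicalType} G (X : Omega -> T) : Prop :=
  forall U : set T, open U -> G (X @^-1` U).

(* [Y] is a version of [E[X | G]], for [X] integrable or nonnegative.  A
   conditional expectation that is finite almost everywhere has a real-valued
   version. *)
Definition is_cond_expectation G X Y : Prop :=
  [/\ P.-integrable setT (EFin \o X) \/ (forall w, 0 <= X w),
      measurable_wrt G Y &
      forall E, G E ->
        (\int[P]_(w in E) (Y w)%:E = \int[P]_(w in E) (X w)%:E)%E].

Definition cond_expectation_le G X Y : Prop :=
  exists2 Z, is_cond_expectation G X Z & {ae P, forall w, Z w <= Y w}.

Definition is_cond_expectation_vec {d : nat} G (X Y : Omega -> 'rV[R]_d) :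
    Prop :=
  forall j, is_cond_expectation G (fun w => X w 0 j) (fun w => Y w 0 j).

(* [Past k] is the information available before iteration [k]; [Mid k] is the
   information available once the stochastic gradients of iteration [k] are
   drawn, before they are compressed. *)
Definition information (Past Mid : nat -> set (set Omega)) : Prop :=
  forall k, [/\ sub_sigma_field (Past k), sub_sigma_field (Mid k),
                Past k `<=` Mid k & Mid k `<=` Past k.+1].

Context {dZ : measure_display} {Z : measurableType dZ}.

(* [seed] has law [Q] and is independent of [G]. *)
Definition fresh_seed (Q : probability Z R) G (seed : Omega -> Z) : Prop :=
  forall E S, G E -> measurable S ->
    (P (E `&` seed @^-1` S) = P E * Q S)%E.

End Probability.

Section Compression.
Context {R : realType} {d : nat} {dZ : measure_display} {Z : measurableType dZ}.

(* A stochastic map is a jointly measurable function of its argument and of a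
   random seed; a deterministic one ignores the seed. *)
Definition absolute_compressor (Q : probability Z R)
    (C : 'rV[R]_d -> Z -> 'rV[R]_d) (Delta : R) : Prop :=
  (forall U : set 'rV[R]_d, open U ->
    measurable
      [set xz : g_sigma_algebraType (@open 'rV[R]_d) * Z | U (C xz.1 xz.2)]) /\
  (forall x : 'rV[R]_d,
    (\int[Q]_z (enorm (C x z - x) ^+ 2)%:E <= (Delta ^+ 2)%:E)%E).

End Compression.

Section ECSGD.
Context {R : realType} {d n : nat} {dO dZ : measure_display}.
Context {Omega : measurableType dO} {Z : measurableType dZ}.
Local Notation V := 'rV[R]_d.

(* [oracle k i h w] is the stochastic gradient computed by worker [i] at
   iteration [k], where [h = [:: x^k; ...; x^0]] is the history of the iterates
   (most recent first) and [w] carries all the randomness.  The oracle is a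
   component of the method that exists before the stepsize is chosen: it can
   use the whole history, but it is not told the stepsize. *)
Variables (oracle : nat -> 'I_n -> seq V -> Omega -> V)
  (C : V -> Z -> V) (seed : nat -> 'I_n -> Omega -> Z) (x0 : V) (gamma : R).

(* State before iteration [k]: the history of the iterates, and the errors. *)
Fixpoint ecsgd (k : nat) (w : Omega) : seq V * ('I_n -> V) :=
  if k is k'.+1 then
    let: (h, e) := ecsgd k' w in
    let g i := oracle k' i h w in
    let v i :=
      gamma *: C (gamma^-1 *: (e i + gamma *: g i)) (seed k' i w) in
    (head 0 h - n%:R^-1 *: \sum_(i < n) v i :: h,
     fun i => e i + gamma *: g i - v i)
  else ([:: x0], fun=> 0).

Definition iterate (k : nat) (w : Omega) : V := head 0 (ecsgd k w).1.

Definition sgrad (k : nat) (i : 'I_n) (w : Omega) : V :=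
  oracle k i (ecsgd k w).1 w.

Definition mean_sgrad (k : nat) (w : Omega) : V :=
  n%:R^-1 *: \sum_(i < n) sgrad k i w.

(* The key parametric assumption on the run with stepsize [gamma]. *)
Definition key_assumption (P : probability Omega R)
    (Past : nat -> set (set Omega)) (f : V -> R) (xs : V)
    (A B C' D1 D2 rho : R) (sigma2 : nat -> Omega -> R) : Prop :=
  forall k,
  [/\ measurable_wrt (Past k) (sigma2 k) /\ (forall w, 0 <= sigma2 k w),
      is_cond_expectation_vec P (Past k) (mean_sgrad k)
        (fun w => grad f (iterate k w)),
      cond_expectation_le P (Past k)
        (fun w => enorm (mean_sgrad k w) ^+ 2)
        (fun w => 2 * A * (f (iterate k w) - f xs) + B * sigma2 k w + D1) &
      cond_expectation_le P (Past k) (sigma2 k.+1)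
        (fun w => (1 - rho) * sigma2 k w
                  + 2 * C' * (f (iterate k w) - f xs) + D2)].

Definition weight (eta : R) (k : nat) : R := (1 - eta) ^- k.+1.

Definition weighted_iterate (eta : R) (K : nat) (w : Omega) : V :=
  (\sum_(k < K.+1) weight eta k)^-1 *:
  \sum_(k < K.+1) weight eta k *: iterate k w.

End ECSGD.

(* Size of the logarithms of [K] and of the parameters [qs]; since [ln 0 = 0],
   a parameter that vanishes contributes nothing. *)
Definition log_size {R : realType} (K : nat) (qs : seq R) : R :=
  1 + ln K%:R + \sum_(q <- qs) `|ln q|.

(* Main.v *)
(* The virtual iterates [xt k = x k - (mean of the local errors)] follow
   [xt (k + 1) = xt k - gamma g k], and the local errors are [gamma] times a
   compression error, so that their second moments are at most
   [gamma ^ 2 Delta ^ 2].  Hence [T k = |xt k - xs| ^ 2 + F gamma ^ 2 sigma k]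
   satisfies
     E T (k + 1) <= (1 - eta) E T k - gamma / 2 E (f (x k) - f xs)
                    + gamma ^ 2 (D1 + F D2) + 6 L gamma ^ 3 Delta ^ 2;
   weighting by [w k], telescoping and Jensen's inequality bound the gap at the
   weighted average, and [gamma] is then tuned.

   When [mu > 0] the tuning needs [mu <= 4 a].  If [4 A <= mu], the bound on the
   second moment of the gradients, assumed for every stepsize, bounds the second
   moments of the iterates uniformly in [gamma].  By induction the iterates are
   then almost surely constant: before the first move the messages do not depend
   on [gamma], so the move would be proportional to [gamma].  The general bound
   with [K] large and [gamma] small then forces [x0 = xs]. *)
From HB Require Import structures.
Require Import Defs.
From mathcomp Require Import finmap measurable_realfun ring lra.

Set Implicit Arguments.
Unset Strict Implicit.
Unset Printing Implicit Defensive.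

Local Open Scope classical_set_scope.
Local Open Scope ring_scope.

(** * Euclidean geometry and convexity *)

Section DotProduct.
Context {R : realType} {d : nat}.
Implicit Types (u v w : 'rV[R]_d) (c : R).

(** The restriction [mu <= 4 * a] has a single source. At a stepsize of order [1 / (mu * K)] the
    initial error carries a prefactor of order [mu * T], whereas the claim allows only [a * T]; if
    [rho / 4] is the smaller part of [eta], the exponential does not depend on the stepsize, and no
    power of a logarithm makes up for the ratio [mu / a]. The case split is on [4 * A <= mu]: its
    negation gives [mu < 4 * A <= 4 * a], and the case itself is what lets quasi-strong convexity
    absorb the term [2 * A] times the gap in the gradient bound. Integrability of the iterates and
    of [sigma2] is not assumed but propagated along the run, and only for the product [F * sigma2]:
    if [F = 0], the mean of [sigma2] may be infinite, and if [F > 0], an infinite initial mean makes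
    the claimed bounds infinite. The tuned stepsize for [mu > 0] uses [log_size] in place of the
    logarithm of a ratio of parameters: a fixed negative power of its exponential lies below every
    monomial of bounded degree in the nonzero parameters that occur. *)

Lemma dotC u v : dot u v = dot v u.
Proof. by apply: eq_bigr => j _; rewrite mulrC. Qed.

Lemma dotDl u v w : dot (u + v) w = dot u w + dot v w.
Proof. by rewrite -big_split; apply: eq_bigr => j _; rewrite mxE mulrDl. Qed.

Lemma dotZl c u v : dot (c *: u) v = c * dot u v.
Proof. by rewrite mulr_sumr; apply: eq_bigr => j _; rewrite mxE mulrA. Qed.

Lemma dotNl u v : dot (- u) v = - dot u v.
Proof. by rewrite -scaleN1r dotZl mulN1r. Qed.

Lemma dotDr u v w : dot u (v + w) = dot u v + dot u w.
Proof. by rewrite dotC dotDl !(dotC u). Qed.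

Lemma dotZr c u v : dot u (c *: v) = c * dot u v.
Proof. by rewrite dotC dotZl dotC. Qed.

Lemma dotNr u v : dot u (- v) = - dot u v.
Proof. by rewrite dotC dotNl dotC. Qed.

Lemma dot0r u : dot u 0 = 0.
Proof. by rewrite -(scale0r (0 : 'rV[R]_d)) dotZr mul0r. Qed.

Definition dotE := (dotDl, dotDr, dotNl, dotNr, dotZl, dotZr).

Lemma dot_ge0 u : 0 <= dot u u.
Proof. by apply: sumr_ge0 => j _; rewrite -expr2 sqr_ge0. Qed.

Lemma enorm_ge0 u : 0 <= enorm u.
Proof. exact: sqrtr_ge0. Qed.

Lemma enorm2 u : enorm u ^+ 2 = dot u u.
Proof. by rewrite sqr_sqrtr ?dot_ge0. Qed.

Lemma enormB u v : enorm (u - v) = enorm (v - u).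
Proof. by rewrite -(opprB v u) /enorm dotNl dotNr opprK. Qed.

Lemma coord_le_enorm2 u j : u 0 j ^+ 2 <= enorm u ^+ 2.
Proof.
rewrite enorm2 /dot (bigD1 j)//= -expr2 lerDl.
by apply: sumr_ge0 => i _; rewrite -expr2 sqr_ge0.
Qed.

Lemma enorm2_eq0 u : enorm u ^+ 2 = 0 -> u = 0.
Proof.
move=> u0; apply/rowP => j; rewrite mxE; apply/eqP.
by rewrite -sqrf_eq0 eq_le sqr_ge0 andbT -u0 coord_le_enorm2.
Qed.

Lemma enorm_eq0 u : enorm u = 0 -> u = 0.
Proof. by move=> u0; apply: enorm2_eq0; rewrite u0 expr0n. Qed.

Lemma dot2_le c u v : 0 < c -> 2 * dot u v <= c * dot u u + c^-1 * dot v v.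
Proof.
move=> c0; have := dot_ge0 (c *: u - v); rewrite !dotE (dotC v u) => h.
rewrite -(ler_pM2l c0) mulrDr (mulrA c c^-1) divff ?gt_eqF// mul1r; nra.
Qed.

Lemma dot_sqr_le u v : dot u v ^+ 2 <= dot u u * dot v v.
Proof.
have [u0|u0] := eqVneq (dot u u) 0.
  have -> : u = 0 by apply: enorm2_eq0; rewrite enorm2.
  by rewrite dotC !dot0r mul0r expr0n.
have {}u0 : 0 < dot u u by rewrite lt_def u0 dot_ge0.
have := dot_ge0 (dot u u *: v - dot u v *: u).
rewrite !dotE (dotC v u) => h.
by rewrite -subr_ge0 -(pmulr_rge0 _ u0); nra.
Qed.

Lemma dot_le_enorm u v : dot u v <= enorm u * enorm v.
Proof.
rewrite (le_trans (ler_norm _))// -(@ler_pXn2r _ 2)// ?nnegrE//.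
  by rewrite exprMn !enorm2 real_normK ?num_real// dot_sqr_le.
by rewrite mulr_ge0// enorm_ge0.
Qed.

Lemma enorm2D_le u v : enorm (u + v) ^+ 2 <= 2 * enorm u ^+ 2 + 2 * enorm v ^+ 2.
Proof. by rewrite !enorm2; have := dot_ge0 (u - v); rewrite !dotE; lra. Qed.

Lemma dot_sumr v (n : nat) (c : 'I_n -> 'rV[R]_d) :
  dot v (\sum_(i < n) c i) = \sum_(i < n) dot v (c i).
Proof.
elim/big_rec2 : _ => [|i x y _ <-]; last by rewrite dotDr.
by rewrite dot0r.
Qed.

Lemma enorm2_sum_le (n : nat) (c : 'I_n -> 'rV[R]_d) :
  enorm (\sum_(i < n) c i) ^+ 2 <= n%:R * \sum_(i < n) enorm (c i) ^+ 2.
Proof.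
rewrite enorm2 dot_sumr -(@ler_pM2l _ 2)// mulr_sumr.
apply: (@le_trans _ _ (\sum_(i < n) \sum_(j < n)
    (enorm (c i) ^+ 2 + enorm (c j) ^+ 2))).
  apply: ler_sum => i _; rewrite dotC dot_sumr mulr_sumr.
  apply: ler_sum => j _; rewrite !enorm2.
  by have := @dot2_le 1 (c i) (c j) ltr01; rewrite invr1 !mul1r.
under eq_bigr do rewrite big_split/= sumr_const card_ord.
rewrite big_split/= sumr_const card_ord sumrMnl -mulr2n.
by rewrite -[X in X *+ 2]mulr_natl -[X in X <= _]mulr_natl.
Qed.

End DotProduct.

(** * First-order inequalities for smooth and quasi-strongly convex functions *)

Section Gradient.
Context {R : realType} {d : nat}.
Variable f : 'rV[R]_d -> R.
Hypothesis df : forall x, differentiable f x.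
Implicit Types (x y v xs : 'rV[R]_d) (mu L : R).

Lemma derive_grad x v : 'D_v f x = dot (grad f x) v.
Proof.
rewrite deriveE// {1}(row_sum_delta v) linear_sum; apply: eq_bigr => j _.
by rewrite linearZ mxE deriveE// -[LHS]/(v 0 j * _) mulrC.
Qed.

Hypothesis cf : @convex_function R 'rV[R]_d setT f.

Lemma convex2 (t : R) x y : 0 <= t <= 1 ->
  f (t *: x + (1 - t) *: y) <= t * f x + (1 - t) * f y.
Proof.
case/andP => t0 t1.
have @t' : {i01 R}.
  exists t => /=; apply/andP; split; rewrite /= ?num_real ?bnd_simp//.
  by apply/andP; split.
exact: (cf t' (in_setT x) (in_setT y)).
Qed.

(** If the directional derivative exceeded [f y - f x], so would the difference quotient at some
    small [t <= 1], against convexity on the segment from [x] to [y]. *)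
Lemma convex_grad x y : f x + dot (grad f x) (y - x) <= f y.
Proof.
rewrite -lerBrDl -derive_grad leNgt; apply/negP => lt_fD.
have cvgD := @diff_derivable _ _ _ _ _ (y - x) (df x).
have h := @cvgr_gt _ _ _ _ _ _ cvgD _ lt_fD.
have [e /= e0 he] := h.
pose t : R := Num.min (e / 2) 1.
have t0 : 0 < t by rewrite lt_min ltr01 divr_gt0.
have t1 : t <= 1 by rewrite ge_min lexx orbT.
have te : t < e by rewrite gt_min ltr_pdivrMr// ltr_pMr ?ltr1n.
have /= := he t; rewrite sub0r normrN gtr0_norm// => /(_ te); rewrite gt_eqF//.
move=> /(_ isT); rewrite ltNge => /negP; apply.
rewrite -[_ *: _]/(t^-1 * _) mulrC ler_pdivrMr//.
have -> : t *: (y - x) + x = t *: y + (1 - t) *: x.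
  by rewrite scalerBr scalerBl scale1r -!addrA (addrC x).
have := @convex2 t y x; rewrite ltW// t1 => /(_ isT); lra.
Qed.

(** Sum the tangent inequalities at the barycentre [z]: the linear terms cancel because the weighted
    sum of the [x k - z] is zero. *)
Lemma jensen (K : nat) (w : 'I_K.+1 -> R) (x : 'I_K.+1 -> 'rV[R]_d) :
  (forall k, 0 < w k) ->
  (\sum_k w k) * f ((\sum_k w k)^-1 *: \sum_k w k *: x k) <= \sum_k w k * f (x k).
Proof.
move=> w0; set W := \sum_k w k; set z := _ *: _.
have W0 : 0 < W.
  by rewrite /W big_ord_recl ltr_pwDl// sumr_ge0// => i _; exact/ltW/w0.
have h k : w k * f z + w k * dot (grad f z) (x k - z) <= w k * f (x k).
  by rewrite -mulrDr ler_pM2l// convex_grad.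
apply: le_trans (ler_sum _ (fun k _ => h k)).
rewrite big_split/= -mulr_suml lerDl.
under eq_bigr do rewrite -dotZr.
rewrite -dot_sumr.
under eq_bigr do rewrite scalerBr.
rewrite sumrB -scaler_suml -/W {2}/z scalerA divff ?gt_eqF// scale1r subrr.
by rewrite dot0r.
Qed.

Variable xs : 'rV[R]_d.
Hypothesis xs_min : unique_minimizer f xs.

Lemma gap_ge0 x : 0 <= f x - f xs.
Proof. by rewrite subr_ge0; have [->//|/xs_min/ltW] := eqVneq x xs. Qed.

Variables mu L : R.
Hypotheses (mu0 : 0 <= mu) (L0 : 0 <= L).
Hypothesis fL : smooth L f.

(* The optimal factor is [2 * L]; [4 * L] only needs first-order convexity. *)
Lemma enorm2_grad_le x : enorm (grad f x) ^+ 2 <= 4 * L * (f x - f xs).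
Proof.
(* The tangent at [y] bounds [f x - f y] below by [t * dot (grad f y) (grad f x)]; replacing
   [grad f y] by [grad f x] costs at most [L * t ^+ 2 * enorm (grad f x) ^+ 2] by smoothness, and
   [f xs <= f y]. *)
have step (t : R) : 0 < t -> t * enorm (grad f x) ^+ 2 * (1 - L * t) <= f x - f xs.
  move=> t0; pose y := x - t *: grad f x.
  have h1 := convex_grad y x; have h2 := gap_ge0 y.
  have /(ler_wpM2l (enorm_ge0 (x - y))) h3 := fL y x.
  have := le_trans (dot_le_enorm (x - y) (grad f x - grad f y)) _.
  have xy : x - y = t *: grad f x by rewrite opprB addrC subrK.
  rewrite (enormB (grad f x)) => /(_ _ h3); rewrite (enormB y) mulrCA -expr2 enorm2 xy !dotE.
  rewrite enorm2 => h4.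
  move: h1; rewrite xy dotZr => h1.
  by rewrite !dotE (dotC (grad f x) (grad f y)) in h4; nra.
have [L_0|L_0] := eqVneq L 0.
  rewrite L_0 mulr0 mul0r leNgt; apply/negP => n0.
  (* When [L = 0] every step length is useful; this one would force a gap of at least
     [f x - f xs + 1]. *)
  have := step ((f x - f xs + 1) / enorm (grad f x) ^+ 2).
  rewrite divr_gt0// ?ltr_wpDl ?gap_ge0// => /(_ isT).
  by rewrite L_0 mul0r subr0 mulr1 divfK ?gt_eqF// gerDl ler10.
have L_gt0 : 0 < L by rewrite lt_def L_0.
(* The maximizer of [t * (1 - L * t)]. *)
have := step (2 * L)^-1; rewrite invr_gt0 mulr_gt0// => /(_ isT).
rewrite (_ : 1 - L * (2 * L)^-1 = 2^-1); last by field.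
rewrite (_ : _ * _ / 2 = enorm (grad f x) ^+ 2 / (4 * L)); last by field.
by rewrite ler_pdivrMr ?mulr_gt0// mulrC.
Qed.

Lemma grad_min : grad f xs = 0.
Proof.
apply: enorm2_eq0; apply/eqP; rewrite eq_le sqr_ge0 andbT.
by have := enorm2_grad_le xs; rewrite subrr mulr0.
Qed.

Hypothesis fmu : quasi_strongly_convex mu xs f.

Lemma qsc_dot x :
  f x - f xs + mu / 2 * enorm (x - xs) ^+ 2 <= dot (grad f x) (x - xs).
Proof. by have := fmu x; rewrite -(opprB x xs) dotNr; lra. Qed.

Lemma dot_grad_le x : dot (grad f x) (x - xs) <= L * enorm (x - xs) ^+ 2.
Proof.
apply: le_trans (dot_le_enorm _ _) _; rewrite expr2 mulrA.
rewrite ler_wpM2r ?enorm_ge0//.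
by have := fL x xs; rewrite grad_min subr0.
Qed.

Lemma gap_le x : f x - f xs <= L * enorm (x - xs) ^+ 2.
Proof.
apply: le_trans (dot_grad_le x); apply: le_trans (qsc_dot x).
by rewrite lerDl mulr_ge0 ?divr_ge0 ?sqr_ge0.
Qed.

(** Quasi-strong convexity and smoothness enclose [dot (grad f x) (x - xs)]. The factor
    [enorm v ^+ 2] stays because [mu <= 2 * L] does not follow in dimension 0, where every norm
    vanishes. *)
Lemma mu_enorm2_le v : mu * enorm v ^+ 2 <= 2 * L * enorm v ^+ 2.
Proof.
have := le_trans (qsc_dot (v + xs)) (dot_grad_le _).
by rewrite addrK; have := gap_ge0 (v + xs); lra.
Qed.

(** Cauchy-Schwarz and the gradient bound give [s ^+ 2 <= p * (4 * L * E)], and the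
    arithmetic-geometric inequality concludes. Comparing squares avoids a division by [L], which may
    be zero. *)
Lemma dot_grad_error x e :
  2 * dot e (grad f x) <= f x - f xs + 4 * L * enorm e ^+ 2.
Proof.
have h := dot_sqr_le e (grad f x); have hg := enorm2_grad_le x.
rewrite -!enorm2 in h.
have d0 := gap_ge0 x; have e0 := sqr_ge0 (enorm e).
rewrite leNgt; apply/negP; set p := f x - f xs in hg d0 *.
set E := enorm e ^+ 2 in h e0 *; set s := dot _ _ in h *.
move=> lt.
have h2 : s ^+ 2 <= E * (4 * L * p) by apply: le_trans h _; rewrite ler_wpM2l.
have h3 : 0 <= 4 * L * E by exact: mulr_ge0 (mulr_ge0 _ L0) e0.
have : (p + 4 * L * E) ^+ 2 < (2 * s) ^+ 2.
  have h4 : 0 <= p + 4 * L * E by exact: addr_ge0.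
  by rewrite ltr_pXn2r// nnegrE// ltW// (le_lt_trans h4).
have := sqr_ge0 (p - 4 * L * E); nra.
Qed.

(* With [e] the mean error, [x - e] is the virtual iterate. *)
Lemma virtual_step x e :
  - (2 * dot (x - e - xs) (grad f x)) <=
  - (f x - f xs) - mu / 2 * enorm (x - e - xs) ^+ 2 + 6 * L * enorm e ^+ 2.
Proof.
(* The constant is [6 = 4 + 2]: [4 * L] pays for the inner product of the error with the gradient,
   and [mu <= 2 * L] in the form [h3] pays for moving the quadratic term from [x] to the virtual
   iterate. *)
have h1 := qsc_dot x; have h2 := dot_grad_error x e; have h3 := mu_enorm2_le e.
have h4 : enorm (x - e - xs) ^+ 2 <= 2 * enorm (x - xs) ^+ 2 + 2 * enorm e ^+ 2.
  have := enorm2D_le (x - xs) (- e); rewrite (enorm2 (- e)) !dotE opprK -enorm2.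
  by rewrite addrAC.
have {}h4 := ler_wpM2l mu0 h4.
rewrite dotC in h1.
have -> : dot (x - e - xs) (grad f x) =
    dot (x - xs) (grad f x) - dot e (grad f x).
  by rewrite !dotE addrAC.
lra.
Qed.

End Gradient.

(** * Measurability with respect to a sub-sigma-field *)

Section MeasurableWrt.
Context {R : realType} {dO : measure_display} {Omega : measurableType dO}.
Implicit Types (G H : set (set Omega)).

Lemma measurable_wrtW {T : topologicalType} G H (X : Omega -> T) :
  G `<=` H -> measurable_wrt G X -> measurable_wrt H X.
Proof. by move=> GH mX U /mX /GH. Qed.

Lemma measurable_wrt_cst {T : topologicalType} G (x : T) :
  sigma_algebra setT G -> measurable_wrt G (fun=> x).
Proof.
move=> [G0 GC _] U _; have [Ux|Ux] := pselect (U x).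
  have -> : (fun=> x) @^-1` U = setT `\` (set0 : set Omega).
    by rewrite setD0; apply/seteqP; split.
  exact: GC.
by have -> : (fun=> x) @^-1` U = (set0 : set Omega) by apply/seteqP; split.
Qed.

Lemma measurable_wrt_continuous {T T' : topologicalType} G (X : Omega -> T)
    (f : T -> T') :
  continuous f -> measurable_wrt G X -> measurable_wrt G (f \o X).
Proof. by move=> /continuousP fc mX U /fc/mX. Qed.

(** Bridge to measurable functions on [Omega] equipped with [G], from which closure under sums,
    products and maxima is inherited; it suffices to test open intervals, which generate the Borel
    sets. *)
Lemma measurable_wrt_funP G (X : Omega -> R) : sigma_algebra setT G ->
  measurable_wrt G X <-> measurable_fun (T := g_sigma_algebraType G) setT X.
Proof.
move=> sG; have GE := measurable_g_measurableTypeE sG; split => [mX|mX U oU].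
  apply: (measurability _ (RGenOpens.measurableE R)) => _ [_ [x [y ->]] <-].
  by rewrite setTI GE; apply: mX; exact: itv_open.
by rewrite -GE -[_ @^-1` _]setTI; apply: mX => //; exact: open_measurable.
Qed.

Lemma measurable_fun_wrt (X : Omega -> R) :
  measurable_wrt measurable X <-> measurable_fun setT X.
Proof.
have sG := @sigma_algebra_measurable _ Omega.
have GE := measurable_g_measurableTypeE sG.
rewrite (measurable_wrt_funP _ sG); split => mX _ U mU.
  by have := mX measurableT U mU; rewrite GE.
by rewrite GE; exact: mX.
Qed.

Lemma measurable_wrt_fun G (X : Omega -> R) :
  G `<=` measurable -> measurable_wrt G X -> measurable_fun setT X.
Proof. by move=> GM mX; apply/measurable_fun_wrt; exact: measurable_wrtW mX. Qed.

Section Real.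
Variable G : set (set Omega).
Hypothesis sG : sigma_algebra setT G.
Implicit Types X Y : Omega -> R.

Lemma measurable_wrtD X Y : measurable_wrt G X -> measurable_wrt G Y ->
  measurable_wrt G (fun w => X w + Y w).
Proof. by rewrite !measurable_wrt_funP//; exact: measurable_funD. Qed.

Lemma measurable_wrtM X Y : measurable_wrt G X -> measurable_wrt G Y ->
  measurable_wrt G (fun w => X w * Y w).
Proof. by rewrite !measurable_wrt_funP//; exact: measurable_funM. Qed.

Lemma measurable_wrtZ c X :
  measurable_wrt G X -> measurable_wrt G (fun w => c * X w).
Proof. by apply: measurable_wrtM; exact: measurable_wrt_cst. Qed.

Lemma measurable_wrt_sum (n : nat) (X : 'I_n -> Omega -> R) :
  (forall i, measurable_wrt G (X i)) ->
  measurable_wrt G (fun w => \sum_(i < n) X i w).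
Proof.
move=> mX; apply/measurable_wrt_funP => //; apply: measurable_sum => i.
exact/measurable_wrt_funP.
Qed.

End Real.

Section Vector.
Variable G : set (set Omega).
Hypothesis sG : sigma_algebra setT G.
Context {d : nat}.
Implicit Types X Y : Omega -> 'rV[R]_d.

Lemma measurable_wrt_coord X j :
  measurable_wrt G X -> measurable_wrt G (fun w => X w 0 j).
Proof. exact: (measurable_wrt_continuous (@coord_continuous _ _ _ 0 j)). Qed.

(* An open set is the union of the rational boxes that it contains. *)
Lemma measurable_wrt_row X :
  (forall j, measurable_wrt G (fun w => X w 0 j)) -> measurable_wrt G X.
Proof.
move=> mX U oU.
have GE := measurable_g_measurableTypeE sG.
pose box (qr : 'rV[rat]_d * rat) : set 'rV[R]_d :=
  [set u | forall j, ratr (qr.1 0 j) - ratr qr.2 < u 0 j < ratr (qr.1 0 j) + ratr qr.2].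
have -> : X @^-1` U = \bigcup_(qr in [set qr | box qr `<=` U]) (X @^-1` box qr).
  apply/seteqP; split => [w /= Uw|w [qr boxU]]; last exact: boxU.
  have /nbhs_ballP[e /= e0 eU] := open_nbhs_nbhs (conj oU Uw).
  have [r /andP[]] : exists r : rat, 0 < (ratr r : R) < e / 2.
    have /rat_in_itvoo[r] : (0 : R) < e / 2 by rewrite divr_gt0.
    by rewrite in_itv/=; exists r.
  move=> r0 re.
  have hq j : exists q : rat, X w 0 j - ratr r < ratr q < X w 0 j + ratr r.
    have /rat_in_itvoo[q] : X w 0 j - ratr r < X w 0 j + ratr r.
      by rewrite ltrD2l gtrN.
    by rewrite in_itv/=; exists q.
  have [q hqP] := choice hq.
  exists (\row_j q j, r) => [/= u boxu|j].
    apply: eU; split => // i j; rewrite (ord1 i) /ball/= ltr_distlC.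
    by have := hqP j; have := boxu j; rewrite /= mxE => /andP[? ?] /andP[? ?];
      apply/andP; split; lra.
  by rewrite /= mxE; have := hqP j => /andP[? ?]; apply/andP; split; lra.
rewrite -GE bigcup_mkcond; apply: countable_bigcupT_measurable => [|qr]; first exact: countableP.
case: ifPn => _ //.
have -> : X @^-1` box qr =
    \bigcap_j ((fun w => X w 0 j) @^-1`
       `]ratr (qr.1 0 j) - ratr qr.2, ratr (qr.1 0 j) + ratr qr.2[%classic).
  apply/seteqP; split => w /= h j; first by rewrite /= in_itv/= => _; exact: h.
  by have /= := h j I; rewrite in_itv.
apply: fin_bigcap_measurable => // j _.
by rewrite GE; apply: mX; exact: itv_open.
Qed.

Lemma measurable_wrt_vecD X Y : measurable_wrt G X -> measurable_wrt G Y ->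
  measurable_wrt G (fun w => X w + Y w).
Proof.
move=> mX mY; apply: measurable_wrt_row => j.
rewrite (_ : (fun _ => _) = fun w => X w 0 j + Y w 0 j); last first.
  by apply/funext => w; rewrite mxE.
by apply: measurable_wrtD => //; exact: measurable_wrt_coord.
Qed.

Lemma measurable_wrt_vecZ c X : measurable_wrt G X ->
  measurable_wrt G (fun w => c *: X w).
Proof.
move=> mX; apply: measurable_wrt_row => j.
rewrite (_ : (fun _ => _) = fun w => c * X w 0 j); last first.
  by apply/funext => w; rewrite mxE.
by apply: measurable_wrtZ => //; exact: measurable_wrt_coord.
Qed.

Lemma measurable_wrt_vecB X Y : measurable_wrt G X -> measurable_wrt G Y ->
  measurable_wrt G (fun w => X w - Y w).
Proof.
move=> mX mY; rewrite (_ : (fun _ => _) = fun w => X w + (-1) *: Y w).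
  by apply: measurable_wrt_vecD => //; exact: measurable_wrt_vecZ.
by apply/funext => w; rewrite scaleN1r.
Qed.

Lemma measurable_wrt_vec_sum (n : nat) (X : 'I_n -> Omega -> 'rV[R]_d) :
  (forall i, measurable_wrt G (X i)) ->
  measurable_wrt G (fun w => \sum_(i < n) X i w).
Proof.
move=> mX; apply: measurable_wrt_row => j.
rewrite (_ : (fun _ => _) = fun w => \sum_i X i w 0 j); last first.
  by apply/funext => w; rewrite summxE.
by apply: measurable_wrt_sum => // i; exact: measurable_wrt_coord.
Qed.

Lemma measurable_wrt_dot X Y : measurable_wrt G X -> measurable_wrt G Y ->
  measurable_wrt G (fun w => dot (X w) (Y w)).
Proof.
move=> mX mY; apply: measurable_wrt_sum => // j.
by apply: measurable_wrtM => //; exact: measurable_wrt_coord.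
Qed.

Lemma measurable_wrt_enorm2 X : measurable_wrt G X ->
  measurable_wrt G (fun w => enorm (X w) ^+ 2).
Proof.
move=> mX; rewrite (_ : (fun _ => _) = fun w => dot (X w) (X w)).
  exact: measurable_wrt_dot.
by apply/funext => w; rewrite enorm2.
Qed.

Lemma measurable_wrt_borel X : measurable_wrt G X ->
  measurable_fun (T := g_sigma_algebraType G)
    (U := g_sigma_algebraType (@open 'rV[R]_d)) setT X.
Proof.
move=> mX; have GE := measurable_g_measurableTypeE sG.
apply: (@measurability _ _ (g_sigma_algebraType G)
  (g_sigma_algebraType (@open 'rV[R]_d)) setT X (@open 'rV[R]_d) erefl).
move=> _ [U oU <-].
by rewrite setTI GE; exact: mX.
Qed.

End Vector.

End MeasurableWrt.

Section CompressorMeasurable.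
Context {R : realType} {d : nat} {dO dZ : measure_display}.
Context {Omega : measurableType dO} {Z : measurableType dZ}.
Variable C : 'rV[R]_d -> Z -> 'rV[R]_d.
Hypothesis mC : forall U : set 'rV[R]_d, open U ->
  measurable
    [set xz : g_sigma_algebraType (@open 'rV[R]_d) * Z | U (C xz.1 xz.2)].

Lemma measurable_wrt_compressor G (Y : Omega -> 'rV[R]_d) (s : Omega -> Z) :
  sigma_algebra setT G -> measurable_wrt G Y ->
  (forall S, measurable S -> G (s @^-1` S)) ->
  measurable_wrt G (fun w => C (Y w) (s w)).
Proof.
move=> sG mY ms U oU.
have GE := measurable_g_measurableTypeE sG.
have mYs : measurable_fun (T := g_sigma_algebraType G)
    (U := (g_sigma_algebraType (@open 'rV[R]_d) * Z)%type) setT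
    (fun w => (Y w, s w)).
  apply: measurable_fun_pair; first exact: measurable_wrt_borel.
  by move=> _ S mS; rewrite setTI GE; exact: ms.
by have := mYs measurableT _ (mC oU); rewrite setTI GE.
Qed.

Lemma measurable_compression_error : measurable_fun setT
  (fun xz : g_sigma_algebraType (@open 'rV[R]_d) * Z =>
     enorm (C xz.1 xz.2 - xz.1) ^+ 2).
Proof.
apply/measurable_fun_wrt; have sG := @sigma_algebra_measurable.
apply: measurable_wrt_enorm2; first exact: sG.
apply: measurable_wrt_vecB; [exact: sG|exact: mC|].
move=> U oU; rewrite -[_ @^-1` _]setTI; apply: measurable_fst => //.
exact: sub_sigma_algebra.
Qed.

End CompressorMeasurable.

(** * Conditional expectations and square-integrable vectors *)

Section Mean.
Context {R : realType} {dO : measure_display} {Omega : measurableType dO}.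
Variable P : probability Omega R.
Implicit Types (X Y Z : Omega -> R) (c : R).

Definition intg X : Prop := P.-integrable setT (EFin \o X).

(* [0] if [X] has infinite mean *)
Definition mean X : R := \int[P]_w X w.

Lemma intg_meas X : intg X -> measurable_fun setT X.
Proof. by move=> /measurable_int /measurable_EFinP. Qed.

Lemma EFin_mean X : intg X -> (\int[P]_w (X w)%:E)%E = (mean X)%:E.
Proof. by move=> iX; rewrite fineK// integrable_fin_num. Qed.

Lemma intg_dom X Y :
  measurable_fun setT X -> (forall w, `|X w| <= Y w) -> intg Y -> intg X.
Proof.
move=> mX XY; apply: le_integrable => //; first exact/measurable_EFinP.
by move=> w _; rewrite lee_fin (le_trans (XY w))// ler_norm.
Qed.

Lemma ge0_intg X : measurable_fun setT X -> (forall w, 0 <= X w) ->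
  (\int[P]_w (X w)%:E < +oo)%E -> intg X.
Proof.
move=> mX X0 Xoo; apply/integrableP; split; first exact/measurable_EFinP.
by under eq_integral do rewrite gee0_abs ?lee_fin//.
Qed.

Lemma eq_intg X Y : X =1 Y -> intg X -> intg Y.
Proof. by move=> /funext ->. Qed.

Lemma eq_mean X Y : X =1 Y -> mean X = mean Y.
Proof. by move=> /funext ->. Qed.

Lemma intg_cst c : intg (fun=> c).
Proof. exact: finite_measure_integrable_cst. Qed.

Lemma mean_cst c : mean (fun=> c) = c.
Proof. by rewrite /mean Rintegral_cst//= probability_setT mulr1. Qed.

Lemma intgD X Y : intg X -> intg Y -> intg (fun w => X w + Y w).
Proof. by move=> iX iY; apply: (eq_integrable _ _ _ _ (integrableD _ iX iY)). Qed.

Lemma meanD X Y : intg X -> intg Y -> mean (fun w => X w + Y w) = mean X + mean Y.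
Proof. by move=> iX iY; rewrite /mean RintegralD. Qed.

Lemma intgZ c X : intg X -> intg (fun w => c * X w).
Proof. by move=> iX; apply: (eq_integrable _ _ _ _ (integrableZl _ _ iX)). Qed.

Lemma meanZ c X : intg X -> mean (fun w => c * X w) = c * mean X.
Proof. by move=> iX; rewrite /mean RintegralZl. Qed.

Lemma intgN X : intg X -> intg (fun w => - X w).
Proof. by move=> iX; apply: (eq_intg _ (intgZ (-1) iX)) => w; rewrite mulN1r. Qed.

Lemma meanN X : intg X -> mean (fun w => - X w) = - mean X.
Proof.
by move=> iX; rewrite -mulN1r -meanZ//; apply: eq_mean => w; rewrite mulN1r.
Qed.

Lemma intgB X Y : intg X -> intg Y -> intg (fun w => X w - Y w).
Proof. by move=> iX iY; apply: intgD => //; exact: intgN. Qed.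

Lemma meanB X Y : intg X -> intg Y -> mean (fun w => X w - Y w) = mean X - mean Y.
Proof. by move=> iX iY; rewrite meanD ?meanN//; exact: intgN. Qed.

Lemma intg_sum (n : nat) (X : 'I_n -> Omega -> R) :
  (forall i, intg (X i)) -> intg (fun w => \sum_(i < n) X i w).
Proof.
elim: n X => [|n IH] X iX.
  by apply: (eq_intg _ (intg_cst 0)) => w; rewrite big_ord0.
have := intgD (iX ord0) (IH _ (fun i => iX (lift ord0 i))).
by apply: eq_intg => w; rewrite big_ord_recl.
Qed.

Lemma mean_sum (n : nat) (X : 'I_n -> Omega -> R) :
  (forall i, intg (X i)) ->
  mean (fun w => \sum_(i < n) X i w) = \sum_(i < n) mean (X i).
Proof.
elim: n X => [|n IH] X iX.
  by rewrite big_ord0 -[RHS](mean_cst 0); apply: eq_mean => w; rewrite big_ord0.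
rewrite big_ord_recl -IH// -meanD//; last exact: intg_sum.
by apply: eq_mean => w; rewrite big_ord_recl.
Qed.

Lemma mean_le X Y : intg X -> intg Y -> (forall w, X w <= Y w) -> mean X <= mean Y.
Proof. by move=> iX iY XY; apply: le_Rintegral. Qed.

Lemma mean_ge0 X : (forall w, 0 <= X w) -> 0 <= mean X.
Proof. by move=> X0; apply: Rintegral_ge0. Qed.

(** Integrability and value travel together, so that the mean of a long linear combination is
    computed in one pass without separate side conditions. *)
Definition has_mean X c : Prop := intg X /\ mean X = c.

Lemma intg_has_mean X : intg X -> has_mean X (mean X).
Proof. by []. Qed.

Lemma has_mean_cst c : has_mean (fun=> c) c.
Proof. by split; [exact: intg_cst|exact: mean_cst]. Qed.

Lemma has_meanD X Y a b : has_mean X a -> has_mean Y b ->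
  has_mean (fun w => X w + Y w) (a + b).
Proof. by move=> [iX <-] [iY <-]; split; [exact: intgD|exact: meanD]. Qed.

Lemma has_meanZ c X a : has_mean X a -> has_mean (fun w => c * X w) (c * a).
Proof. by move=> [iX <-]; split; [exact: intgZ|exact: meanZ]. Qed.

Lemma has_meanN X a : has_mean X a -> has_mean (fun w => - X w) (- a).
Proof. by move=> [iX <-]; split; [exact: intgN|exact: meanN]. Qed.

Lemma has_meanB X Y a b : has_mean X a -> has_mean Y b ->
  has_mean (fun w => X w - Y w) (a - b).
Proof. by move=> hX hY; apply: has_meanD => //; exact: has_meanN. Qed.

Lemma has_mean_sum (n : nat) (X : 'I_n -> Omega -> R) (a : 'I_n -> R) :
  (forall i, has_mean (X i) (a i)) ->
  has_mean (fun w => \sum_(i < n) X i w) (\sum_(i < n) a i).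
Proof.
move=> hX; split; first by apply: intg_sum => i; exact: (hX i).1.
by rewrite mean_sum => [|i]; [apply: eq_bigr => i _|]; have [] := hX i.
Qed.

Lemma eq_has_mean X Y a : X =1 Y -> has_mean X a -> has_mean Y a.
Proof. by move=> /funext ->. Qed.

Lemma has_mean_le X Y a b : has_mean X a -> has_mean Y b ->
  (forall w, X w <= Y w) -> a <= b.
Proof. by move=> [iX <-] [iY <-]; exact: mean_le. Qed.

Lemma ae_le_integral X Y : measurable_fun setT X -> measurable_fun setT Y ->
  {ae P, forall w, X w <= Y w} ->
  (\int[P]_w (X w)%:E <= \int[P]_w (Y w)%:E)%E.
Proof.
move=> /measurable_EFinP mX /measurable_EFinP mY XY.
rewrite integralE [leRHS]integralE leeB//; apply: ae_ge0_le_integral => //.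
- exact: measurable_funepos.
- exact: measurable_funepos.
- apply: filterS XY => w XYw _; rewrite !funeposE/= -!EFin_max lee_fin.
  by rewrite ge_max !le_max XYw lexx orbT.
- exact: measurable_funeneg.
- exact: measurable_funeneg.
- apply: filterS XY => w XYw _; rewrite !funenegE/= -!EFin_max lee_fin.
  by rewrite ge_max !le_max lerN2 XYw lexx orbT.
Qed.

(** The whole space belongs to [G]. The left side is an extended integral because integrability of
    [X] is usually not yet known: for nonnegative [X] it is deduced from this finite bound. *)
Lemma cond_expectation_le_integral G X Y : G `<=` measurable -> sigma_algebra setT G ->
  intg Y -> cond_expectation_le P G X Y ->
  (\int[P]_w (X w)%:E <= (mean Y)%:E)%E.
Proof.
move=> GM sG iY [Z [_ mZ ZE] ZY].
have GT : G setT by case: sG => G0 GC _; have := GC _ G0; rewrite setD0.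
rewrite -(ZE _ GT) -EFin_mean//; apply: ae_le_integral => //.
  exact: measurable_wrt_fun mZ.
exact: intg_meas.
Qed.

Section TakingOutWhatIsKnown.
Variable G : set (set Omega).
Hypotheses (sG : sigma_algebra setT G) (GM : G `<=` measurable).
Variable X : Omega -> R.
Hypotheses (iX : intg X).
Hypothesis X0 : forall E, G E -> (\int[P]_(w in E) (X w)%:E = 0)%E.

Import HBNNSimple.

(** [phi] is a finite combination of indicators of its level sets; these lie in [G], and [X]
    integrates to zero over each. *)
Lemma integral_simple_mul (phi : {nnsfun (g_sigma_algebraType G) >-> R}) :
  (\int[P]_w (phi w * X w)%:E = 0)%E.
Proof.
have sub_G (E : set (g_sigma_algebraType G)) : measurable E -> G E.
  by rewrite (measurable_g_measurableTypeE sG).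
have GE y : G (phi @^-1` [set y]) by apply: sub_G; exact: measurable_sfunP.
have mE y : measurable (phi @^-1` [set y] : set Omega) by exact: GM.
have iE y : intg (fun w => \1_(phi @^-1` [set y]) w * X w).
  apply: intg_dom (intgZ 1 (integrable_abse iX)); last first.
    move=> w; rewrite mul1r normrM indicE ger0_norm ?ler0n//.
    by rewrite ler_piMl// lern1 leq_b1.
  by apply: measurable_funM; [exact: measurable_indic|exact: intg_meas].
have mean0 y : mean (fun w => \1_(phi @^-1` [set y]) w * X w) = 0.
  apply/EFin_inj; rewrite -EFin_mean//.
  rewrite -[RHS](X0 (GE y)) [RHS]integral_mkcond; apply: eq_integral => w _.
  rewrite patchE indicE; case: ifPn => _; first by rewrite mul1r.
  by rewrite mul0r.
pose s := fset_set (range phi).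
have -> : (\int[P]_w (phi w * X w)%:E = \int[P]_w (\sum_(i < size s)
    nth 0 s i * (\1_(phi @^-1` [set nth 0 s i]) w * X w))%:E)%E.
  apply: eq_integral => w _; congr EFin; rewrite [X in X * _](fimfunE phi) fsbig_finite//=.
  rewrite mulr_suml (big_nth 0) big_mkord; apply: eq_bigr => i _.
  by rewrite mulrA.
rewrite EFin_mean; last by apply: intg_sum => i; exact: intgZ.
rewrite mean_sum => [|i]; last exact: intgZ.
by rewrite big1// => i _; rewrite meanZ// mean0 mulr0.
Qed.

(** Simple [G]-measurable functions approximate [Z] from below, so their products with [X] are
    dominated by the absolute value of [Z * X], and dominated convergence applies. *)
Lemma mean_mul_ge0 Z : measurable_wrt G Z -> (forall w, 0 <= Z w) ->
  intg (fun w => Z w * X w) -> mean (fun w => Z w * X w) = 0.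
Proof.
move=> mZ Z0 iZX.
have mZG : measurable_fun (T := g_sigma_algebraType G) setT (EFin \o Z).
  by apply/measurable_EFinP; exact/measurable_wrt_funP.
pose phi := nnsfun_approx measurableT mZG.
have Z0' w : setT w -> (0 <= (EFin \o Z) w)%E by rewrite lee_fin.
have mphi n : measurable_fun setT (phi n : Omega -> R).
  apply: (@measurable_wrt_fun _ _ _ G) => //; apply/measurable_wrt_funP => //.
have mf_ n : measurable_fun [set: Omega] (fun w : Omega => (phi n w * X w)%:E).
  by apply/measurable_EFinP; apply: measurable_funM => //; exact: intg_meas iX.
have cvg_f : {ae P, forall w : Omega, setT w ->
    (phi n w * X w)%:E @[n --> \oo] --> (Z w * X w)%:E}.
  apply: aeW => w _; apply: cvg_EFin; first exact: nearW.
  by apply: cvgMl; have /fine_cvg := cvg_nnsfun_approx measurableT mZG Z0' (I : setT w).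
have dom_f : {ae P, forall w : Omega, forall n, setT w ->
    (`|(phi n w * X w)%:E| <= `|(Z w * X w)%:E|)%E}.
  apply: aeW => w n _; rewrite /= lee_fin !normrM ler_wpM2r//.
  rewrite ger0_norm// ger0_norm// -lee_fin /phi nnsfun_approxE.
  exact: le_approx Z0' _.
have [_ _] := dominated_convergence measurableT mf_ (measurable_int _ iZX)
  cvg_f (integrable_abse iZX) dom_f.
under eq_fun do rewrite integral_simple_mul.
move=> /cvg_lim; rewrite lim_cst// => /(_ _)/esym h.
by apply/EFin_inj; rewrite -EFin_mean// h.
Qed.

End TakingOutWhatIsKnown.

(** [X - Y] integrates to zero over every set of [G]; the positive and negative parts of [Z] reduce
    the claim to nonnegative factors. *)
Lemma cond_expectation_mul G X Y Z : sigma_algebra setT G -> G `<=` measurable ->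
  is_cond_expectation P G X Y -> measurable_wrt G Z -> intg X -> intg Y ->
  intg (fun w => Z w * X w) -> intg (fun w => Z w * Y w) ->
  mean (fun w => Z w * X w) = mean (fun w => Z w * Y w).
Proof.
move=> sG GM [_ mY YX] mZ iX iY iZX iZY.
pose D w := X w - Y w.
have iD : intg D by exact: intgB.
have D0 E : G E -> (\int[P]_(w in E) (D w)%:E = 0)%E.
  move=> GEE; have mE := GM _ GEE.
  have iXE := integrableS measurableT mE (@subsetT _ E) iX.
  have iYE := integrableS measurableT mE (@subsetT _ E) iY.
  rewrite (eq_integral (fun w => (X w)%:E - (Y w)%:E)%E)//.
  rewrite integralB// YX// subee// integrable_fin_num//.
have mZ' := measurable_wrt_fun GM mZ.
have iZD : intg (fun w => Z w * D w).
  by apply: (eq_intg _ (intgB iZX iZY)) => w; rewrite mulrBr.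
have mZp : measurable_wrt G (fun w => Num.max (Z w) 0).
  apply/measurable_wrt_funP => //; apply: measurable_maxr => //.
  exact/measurable_wrt_funP.
have mZn : measurable_wrt G (fun w => Num.max (- Z w) 0).
  apply/measurable_wrt_funP => //; apply: measurable_maxr => //.
  by apply: measurable_funN; exact/measurable_wrt_funP.
have iZp : intg (fun w => Num.max (Z w) 0 * D w).
  apply: intg_dom (integrable_abse iZD).
    apply: measurable_funM; [exact: measurable_wrt_fun mZp|exact: intg_meas].
  move=> w; rewrite !normrM ler_wpM2r// ger0_norm ?le_max ?lexx ?orbT//.
  by rewrite ge_max ler_norm normr_ge0.
have iZn : intg (fun w => Num.max (- Z w) 0 * D w).
  apply: intg_dom (integrable_abse iZD).
    apply: measurable_funM; [exact: measurable_wrt_fun mZn|exact: intg_meas].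
  move=> w; rewrite !normrM ler_wpM2r// ger0_norm ?le_max ?lexx ?orbT//.
  by rewrite ge_max -normrN ler_norm normr_ge0.
apply/eqP; rewrite -subr_eq0 -meanB//; apply/eqP.
rewrite (@eq_mean _ (fun w => Num.max (Z w) 0 * D w - Num.max (- Z w) 0 * D w)).
  rewrite meanB// !(mean_mul_ge0 sG GM iD D0) ?subrr// => w;
    by rewrite le_max lexx orbT.
move=> w; rewrite -mulrBr -mulrBl; congr (_ * _).
by case: (lerP (Z w) 0) => [z0|z0]; rewrite /Num.max; do 2 case: ltrP; lra.
Qed.

End Mean.

Section CompressionError.
Context {R : realType} {d : nat} {dO dZ : measure_display}.
Context {Omega : measurableType dO} {Z : measurableType dZ}.
Variables (P : probability Omega R) (Q : probability Z R).
Variables (C : 'rV[R]_d -> Z -> 'rV[R]_d) (Delta : R).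
Hypothesis hC : absolute_compressor Q C Delta.
Local Notation B := (g_sigma_algebraType (@open 'rV[R]_d)).

(** Freshness makes the joint law of argument and seed agree on rectangles with the product of the
    law of [Y] and [Q], hence equal to it. Tonelli then integrates over the seed first, with the
    argument fixed, where the compressor bound holds. *)
Lemma compression_error G (Y : Omega -> 'rV[R]_d) (s : Omega -> Z) :
  sub_sigma_field G -> measurable_wrt G Y ->
  (forall S, measurable S -> measurable (s @^-1` S)) -> fresh_seed P Q G s ->
  (\int[P]_w (enorm (C (Y w) (s w) - Y w) ^+ 2)%:E <= (Delta ^+ 2)%:E)%E.
Proof.
case: hC => mC errC [sG GM] mY ms fresh.
have mYB : measurable_fun (T := Omega) (U := B) setT Y.
  move=> _ U mU; rewrite setTI; apply: GM.
  have := measurable_wrt_borel sG mY measurableT mU.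
  by rewrite setTI (measurable_g_measurableTypeE sG).
have ms' : measurable_fun setT s by move=> _ S mS; rewrite setTI; exact: ms.
have GY (U : set B) : measurable U -> G (Y @^-1` U).
  move=> mU; have := measurable_wrt_borel sG mY measurableT mU.
  by rewrite setTI (measurable_g_measurableTypeE sG).
have mYs : measurable_fun (U := (B * Z)%type) setT (fun w => (Y w, s w)).
  exact: measurable_fun_pair.
pose h (xz : B * Z) := (enorm (C xz.1 xz.2 - xz.1) ^+ 2)%:E.
have mh : measurable_fun setT h.
  by apply/measurable_EFinP; exact: measurable_compression_error.
have h0 xz : (0 <= h xz)%E by rewrite lee_fin sqr_ge0.
pose Y' : {mfun Omega >-> B} := HB.pack Y (isMeasurableFun.Build _ _ Omega B Y mYB).
pose Ys' : {mfun Omega >-> (B * Z)%type} :=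
  HB.pack (fun w => (Y w, s w)) (isMeasurableFun.Build _ _ Omega (B * Z)%type _ mYs).
have -> : (\int[P]_w (enorm (C (Y w) (s w) - Y w) ^+ 2)%:E =
    \int[distribution P Ys']_xz h xz)%E.
  by rewrite ge0_integral_distribution.
rewrite (eq_measure_integral (distribution P Y' \x Q)%E); last first.
  move=> A mA _; apply/esym; apply: product_measure_unique => // U S mU mS.
  exact: fresh (GY _ mU) mS.
rewrite fubini_tonelli1//.
apply: (@le_trans _ _ (\int[distribution P Y']_x (Delta ^+ 2)%:E)%E).
  apply: ge0_le_integral => //.
  - by move=> x _; apply: integral_ge0.
  - exact: measurable_fun_fubini_tonelli_F.
  - by move=> x _; exact: errC.
by rewrite integral_cst//= probability_setT mule1.
Qed.

End CompressionError.

(** * Square-integrable random vectors *)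

Section SquareIntegrable.
Context {R : realType} {dO : measure_display} {Omega : measurableType dO}.
Variable P : probability Omega R.
Context {d : nat}.
Implicit Types (X Y : Omega -> 'rV[R]_d).

Definition sqintg X : Prop :=
  measurable_wrt measurable X /\ intg P (fun w => enorm (X w) ^+ 2).

Let sM := @sigma_algebra_measurable _ Omega.

Lemma sqintg_le X (Y : Omega -> R) : measurable_wrt measurable X ->
  intg P Y -> (forall w, enorm (X w) ^+ 2 <= Y w) -> sqintg X.
Proof.
move=> mX iY XY; split => //; apply: intg_dom iY.
  by apply/measurable_fun_wrt; exact: measurable_wrt_enorm2.
by move=> w; rewrite ger0_norm// sqr_ge0.
Qed.

Lemma sqintg_cst (x : 'rV[R]_d) : sqintg (fun=> x).
Proof. by split; [exact: measurable_wrt_cst|exact: intg_cst]. Qed.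

Lemma sqintgD X Y : sqintg X -> sqintg Y -> sqintg (fun w => X w + Y w).
Proof.
move=> [mX iX] [mY iY]; apply: sqintg_le (fun w => enorm2D_le (X w) (Y w)).
  exact: measurable_wrt_vecD.
by apply: intgD; exact: intgZ.
Qed.

Lemma sqintgZ c X : sqintg X -> sqintg (fun w => c *: X w).
Proof.
move=> [mX iX]; apply: (@sqintg_le _ (fun w => c ^+ 2 * enorm (X w) ^+ 2)).
- exact: measurable_wrt_vecZ.
- exact: intgZ.
- by move=> w; rewrite !enorm2 dotZl dotZr mulrA.
Qed.

Lemma sqintgB X Y : sqintg X -> sqintg Y -> sqintg (fun w => X w - Y w).
Proof.
move=> sX sY; have := sqintgD sX (sqintgZ (-1) sY).
by under eq_fun do rewrite scaleN1r.
Qed.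

Lemma sqintg_coordM X Y j : sqintg X -> sqintg Y ->
  intg P (fun w => X w 0 j * Y w 0 j).
Proof.
move=> [mX iX] [mY iY]; apply: intg_dom (intgD iX iY).
  by apply/measurable_fun_wrt; apply: measurable_wrtM => //;
    exact: measurable_wrt_coord.
move=> w; have hX := coord_le_enorm2 (X w) j; have hY := coord_le_enorm2 (Y w) j.
rewrite ler_norml; have := sqr_ge0 (X w 0 j + Y w 0 j).
have := sqr_ge0 (X w 0 j - Y w 0 j).
have := sqr_ge0 (X w 0 j); have := sqr_ge0 (Y w 0 j).
by move=> *; apply/andP; split; nra.
Qed.

Lemma sqintg_dot X Y : sqintg X -> sqintg Y -> intg P (fun w => dot (X w) (Y w)).
Proof. by move=> sX sY; apply: intg_sum => j; exact: sqintg_coordM. Qed.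

Lemma sqintg_coord X j : sqintg X -> intg P (fun w => X w 0 j).
Proof.
move=> sX; have := sqintg_coordM j sX (sqintg_cst (const_mx 1)).
by apply: eq_intg => w; rewrite mxE mulr1.
Qed.

Lemma cond_expectation_dot G X Y Z : sub_sigma_field G ->
  is_cond_expectation_vec P G X Y -> measurable_wrt G Z ->
  sqintg X -> sqintg Y -> sqintg Z ->
  mean P (fun w => dot (Z w) (X w)) = mean P (fun w => dot (Z w) (Y w)).
Proof.
move=> [sG GM] XY mZ sX sY sZ.
rewrite !mean_sum; [|by move=> j; exact: sqintg_coordM..].
apply: eq_bigr => j _; apply: (cond_expectation_mul sG GM (XY j)).
- exact: measurable_wrt_coord.
- exact: sqintg_coord.
- exact: sqintg_coord.
- exact: sqintg_coordM.
- exact: sqintg_coordM.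
Qed.

End SquareIntegrable.

(** * Moments along a run *)

Section Dynamics.
Context {R : realType} {d n : nat} {dO dZ : measure_display}.
Context {Omega : measurableType dO} {Z : measurableType dZ}.
Local Notation V := 'rV[R]_d.
Variables (oracle : nat -> 'I_n -> seq V -> Omega -> V)
  (comp : V -> Z -> V) (seed : nat -> 'I_n -> Omega -> Z) (x0 : V) (gamma : R).

Definition local_error (k : nat) (i : 'I_n) (w : Omega) : V :=
  (ecsgd oracle comp seed x0 gamma k w).2 i.

Definition mean_error (k : nat) (w : Omega) : V :=
  n%:R^-1 *: \sum_(i < n) local_error k i w.

Local Notation x := (iterate oracle comp seed x0 gamma).
Local Notation g := (sgrad oracle comp seed x0 gamma).
Local Notation gm := (mean_sgrad oracle comp seed x0 gamma).

Definition virtual_iterate (k : nat) (w : Omega) : V := x k w - mean_error k w.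

Definition message (k : nat) (i : 'I_n) (w : Omega) : V :=
  gamma^-1 *: (local_error k i w + gamma *: g k i w).

Lemma historyS k w : (ecsgd oracle comp seed x0 gamma k.+1 w).1 =
  x k.+1 w :: (ecsgd oracle comp seed x0 gamma k w).1.
Proof. by rewrite /iterate /=; case: (ecsgd _ _ _ _ _ k w). Qed.

Lemma iterateS k w : x k.+1 w =
  x k w - n%:R^-1 *: \sum_(i < n) gamma *: comp (message k i w) (seed k i w).
Proof.
by rewrite /message /local_error /sgrad /iterate /=; case: (ecsgd _ _ _ _ _ k w).
Qed.

Lemma local_error0 i w : local_error 0 i w = 0.
Proof. by []. Qed.

Lemma local_errorS k i w : local_error k.+1 i w =
  local_error k i w + gamma *: g k i w - gamma *: comp (message k i w) (seed k i w).
Proof.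
by rewrite /message /local_error /sgrad /iterate /=; case: (ecsgd _ _ _ _ _ k w).
Qed.

Lemma virtual_iterate0 w : virtual_iterate 0 w = x0.
Proof. by rewrite /virtual_iterate /mean_error big1// scaler0 subr0. Qed.

(** The compressed messages are subtracted both from the iterate and from the mean error, so they
    cancel in the difference. *)
Lemma virtual_iterateS k w :
  virtual_iterate k.+1 w = virtual_iterate k w - gamma *: gm k w.
Proof.
rewrite /virtual_iterate /mean_error /mean_sgrad iterateS.
under [X in _ - _ - n%:R^-1 *: X]eq_bigr do rewrite local_errorS.
rewrite big_split big_split/= sumrN -[\sum_i gamma *: sgrad _ _ _ _ _ _ _ _]scaler_sumr.
rewrite scalerBr scalerDr opprB addrA subrK opprD addrA.
by rewrite !scalerA (mulrC gamma).
Qed.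

Hypothesis gamma0 : 0 < gamma.

Lemma local_errorS_compression k i w : local_error k.+1 i w =
  - gamma *: (comp (message k i w) (seed k i w) - message k i w).
Proof.
rewrite local_errorS scaleNr scalerBr opprB; congr (_ - _).
by rewrite scalerA divff ?gt_eqF// scale1r.
Qed.

Section Measurability.
Variables (P : probability Omega R) (Q : probability Z R) (Delta : R).
Variables Past Mid : nat -> set (set Omega).
Hypothesis hC : absolute_compressor Q comp Delta.
Hypothesis hI : information Past Mid.
Hypothesis hfresh : forall k i, fresh_seed P Q (Mid k) (seed k i).
Hypothesis hseed :
  forall k i S, measurable S -> Past k.+1 (seed k i @^-1` S).
Hypothesis mg : forall k i, measurable_wrt (Mid k) (g k i).

Let sPast k : sigma_algebra setT (Past k).
Proof. by have [[]] := hI k. Qed.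

Let PastM k : Past k `<=` measurable.
Proof. by have [[]] := hI k. Qed.

Let sMid k : sigma_algebra setT (Mid k).
Proof. by have [_ []] := hI k. Qed.

Let MidM k : Mid k `<=` measurable.
Proof. by have [_ []] := hI k. Qed.

Let PastMid k : Past k `<=` Mid k.
Proof. by have [_ _] := hI k. Qed.

Let MidPast k : Mid k `<=` Past k.+1.
Proof. by have [_ _ _] := hI k. Qed.

(** Stated conditionally so that it can be used inside the induction on the local errors. *)
Lemma measurable_message_of k i :
  measurable_wrt (Past k) (local_error k i) -> measurable_wrt (Mid k) (message k i).
Proof.
move=> me; apply: measurable_wrt_vecZ => //; apply: measurable_wrt_vecD => //.
  exact: measurable_wrtW me.
exact: measurable_wrt_vecZ.
Qed.

Lemma measurable_compressed k i : measurable_wrt (Mid k) (message k i) ->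
  measurable_wrt (Past k.+1) (fun w => comp (message k i w) (seed k i w)).
Proof.
move=> mm; case: hC => mC _; apply: (measurable_wrt_compressor mC) => //.
  exact: measurable_wrtW mm.
by move=> S mS; exact: hseed.
Qed.

Lemma measurable_local_error k i : measurable_wrt (Past k) (local_error k i).
Proof.
elim: k i => [|k IH] i; first exact: measurable_wrt_cst.
rewrite (_ : local_error k.+1 i = fun w => local_error k i w + gamma *: g k i w
    - gamma *: comp (message k i w) (seed k i w)); last first.
  by apply/funext => w; rewrite local_errorS.
have mm := measurable_message_of (IH i).
apply: measurable_wrt_vecB => //.
  apply: measurable_wrt_vecD => //.
    by apply: measurable_wrtW (IH i) => E /PastMid /MidPast.
  by apply: measurable_wrt_vecZ => //; exact: measurable_wrtW (mg k i).
by apply: measurable_wrt_vecZ => //; exact: measurable_compressed.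
Qed.

Lemma measurable_message k i : measurable_wrt (Mid k) (message k i).
Proof. exact: measurable_message_of (measurable_local_error k i). Qed.

Lemma measurable_iterate k : measurable_wrt (Past k) (x k).
Proof.
elim: k => [|k IH]; first exact: measurable_wrt_cst.
rewrite (_ : x k.+1 = fun w => x k w - n%:R^-1 *: \sum_(i < n)
    gamma *: comp (message k i w) (seed k i w)); last first.
  by apply/funext => w; rewrite iterateS.
apply: measurable_wrt_vecB => //.
  by apply: measurable_wrtW IH => E /PastMid /MidPast.
apply: measurable_wrt_vecZ => //; apply: measurable_wrt_vec_sum => // i.
apply: measurable_wrt_vecZ => //; apply: measurable_compressed.
exact: measurable_message.
Qed.

Lemma measurable_mean_error k : measurable_wrt (Past k) (mean_error k).
Proof.
apply: measurable_wrt_vecZ => //; apply: measurable_wrt_vec_sum => // i.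
exact: measurable_local_error.
Qed.

Lemma measurable_virtual k : measurable_wrt (Past k) (virtual_iterate k).
Proof.
apply: measurable_wrt_vecB => //; first exact: measurable_iterate.
exact: measurable_mean_error.
Qed.

Lemma measurable_mean_sgrad k : measurable_wrt (Mid k) (gm k).
Proof.
apply: measurable_wrt_vecZ => //; exact: measurable_wrt_vec_sum.
Qed.

Lemma local_error_moment k i : intg P (fun w => enorm (local_error k i w) ^+ 2) /\
  mean P (fun w => enorm (local_error k i w) ^+ 2) <= gamma ^+ 2 * Delta ^+ 2.
Proof.
case: k => [|k].
  have z w : enorm (local_error 0 i w) ^+ 2 = 0 by rewrite local_error0 enorm2 dot0r.
  rewrite (funext z) mean_cst mulr_ge0 ?sqr_ge0//; split => //; exact: intg_cst.
pose E w := enorm (comp (message k i w) (seed k i w) - message k i w) ^+ 2.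
(* [Mid k] is the right moment to condition on: the message is already determined, while the seed is
   still independent. *)
have hE : (\int[P]_w (E w)%:E <= (Delta ^+ 2)%:E)%E.
  apply: (compression_error hC (conj (sMid k) (@MidM k))) => //.
    exact: measurable_message.
  by move=> S mS; apply: (@PastM k.+1); exact: hseed.
have iE : intg P E.
  apply: ge0_intg => [|w|]; [|exact: sqr_ge0|exact: le_lt_trans hE (ltry _)].
  apply: (measurable_wrt_fun (@PastM k.+1)).
  apply: measurable_wrt_enorm2 => //; apply: measurable_wrt_vecB => //.
    exact: measurable_compressed (measurable_message k i).
  exact: measurable_wrtW (measurable_message k i).
have eE w : enorm (local_error k.+1 i w) ^+ 2 = gamma ^+ 2 * E w.
  rewrite local_errorS_compression /E !enorm2 dotZl dotZr mulrA.
  by rewrite mulrNN -expr2.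
rewrite (funext eE) meanZ//; split; first exact: intgZ.
by rewrite ler_wpM2l ?sqr_ge0// -lee_fin -EFin_mean.
Qed.

Hypothesis n0 : (0 < n)%N.

Lemma mean_error_moment k : sqintg P (mean_error k) /\
  mean P (fun w => enorm (mean_error k w) ^+ 2) <= gamma ^+ 2 * Delta ^+ 2.
Proof.
pose S w := \sum_(i < n) enorm (local_error k i w) ^+ 2.
have iS : intg P S by apply: intg_sum => i; exact: (local_error_moment k i).1.
have nR : 0 < n%:R :> R by rewrite ltr0n.
have le w : enorm (mean_error k w) ^+ 2 <= n%:R^-1 * S w.
  rewrite enorm2 /mean_error dotZl dotZr -enorm2 mulrA -expr2.
  rewrite -(ler_pM2l (exprn_gt0 2 nR)) mulrA -exprMn divff ?gt_eqF// expr1n mul1r.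
  have -> : n%:R ^+ 2 * (n%:R^-1 * S w) = n%:R * S w.
    by rewrite mulrA expr2 mulfK ?gt_eqF.
  exact: enorm2_sum_le.
have se : sqintg P (mean_error k).
  apply: sqintg_le (intgZ _ iS) le.
  exact: measurable_wrtW (@PastM k) (measurable_mean_error k).
split => //; apply: le_trans (mean_le se.2 (intgZ _ iS) le) _.
rewrite meanZ// mean_sum => [|i]; last exact: (local_error_moment k i).1.
rewrite mulrC ler_pdivrMr//.
apply: (@le_trans _ _ (\sum_(i < n) gamma ^+ 2 * Delta ^+ 2)).
  by apply: ler_sum => i _; exact: (local_error_moment k i).2.
by rewrite sumr_const card_ord [leRHS]mulr_natr.
Qed.

End Measurability.

End Dynamics.

(** * Real arithmetic of the recursion and of the weights *)

Lemma dist_arith (R : realType) (gamma mu L e e2 s r D G : R) :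
  6 * L * gamma * e <= 6 * L * gamma * (gamma ^+ 2 * e2) ->
  gamma * - (2 * s) <= gamma * (- D - mu / 2 * r + 6 * L * e) ->
  r - 2 * gamma * s + gamma ^+ 2 * G <=
  (1 - gamma * mu / 2) * r - gamma * D + 6 * L * gamma * (gamma ^+ 2 * e2)
    + gamma ^+ 2 * G.
Proof. by lra. Qed.

(** Here [r] is the mean squared distance, [s] the mean of [F * sigma2], [D] the mean gap. The gap
    has coefficient [- gamma + 2 * gamma ^+ 2 * (A + C * F)], at most [- gamma / 2] by the stepsize
    restriction; [s] has [gamma ^+ 2 * (3 / 4 * rho + 1 - rho)]. *)
Lemma lyapunov_arith (R : realType)
    (gamma eta mu rho A C F L D1 D2 e2 r r' s s' D G : R) :
  0 <= gamma -> gamma <= 1 / (4 * (A + C * F)) -> 0 < A + C * F ->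
  eta <= gamma * mu / 2 -> eta <= rho / 4 -> 0 <= D -> 0 <= r -> 0 <= s ->
  r' <= (1 - gamma * mu / 2) * r - gamma * D + 6 * L * gamma * (gamma ^+ 2 * e2)
        + gamma ^+ 2 * G ->
  G <= 2 * A * D + 3 / 4 * rho * s + D1 ->
  s' <= (1 - rho) * s + 2 * (C * F) * D + F * D2 ->
  r' + gamma ^+ 2 * s' <= (1 - eta) * (r + gamma ^+ 2 * s) - gamma / 2 * D
    + (gamma ^+ 2 * (D1 + F * D2) + 6 * L * gamma * (gamma ^+ 2 * e2)).
Proof.
move=> g0 + a0 e1 e2' D0 r0 s0 h1 h2 h3; rewrite ler_pdivlMr ?mulr_gt0// => ga.
have g2 : 0 <= gamma ^+ 2 by exact: sqr_ge0.
have {}h2 := ler_wpM2l g2 h2; have {}h3 := ler_wpM2l g2 h3.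
have {}e1 := ler_wpM2r r0 e1.
have {}e2' := ler_wpM2r (mulr_ge0 g2 s0) e2'.
have {}ga := ler_wpM2l (mulr_ge0 g0 D0) ga.
lra.
Qed.

Lemma weighted_arith (R : realType) (gamma W W' N D LD S T0 : R) :
  0 < gamma -> 0 < W -> W' <= W -> 0 < W' -> 0 <= T0 ->
  N = gamma ^+ 2 * D + 6 * LD * gamma ^+ 3 ->
  gamma / 2 * S <= T0 + W * N ->
  W^-1 * S <= 2 / gamma * T0 / W' + 2 * gamma * D + 12 * LD * gamma ^+ 2.
Proof.
move=> g0 W0 WW' W'0 T00 -> h.
have -> : W^-1 * S = 2 / gamma * (W^-1 * (gamma / 2 * S)).
  by field; rewrite !gt_eqF.
apply: (@le_trans _ _ (2 / gamma * (W^-1 * (T0 + W * (gamma ^+ 2 * D + 6 * LD * gamma ^+ 3))))).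
  by rewrite ler_pM2l ?divr_gt0// ler_pM2l// invr_gt0.
have -> : 2 / gamma * (W^-1 * (T0 + W * (gamma ^+ 2 * D + 6 * LD * gamma ^+ 3)))
  = 2 / gamma * T0 / W + 2 * gamma * D + 12 * LD * gamma ^+ 2.
  by field; rewrite !gt_eqF.
rewrite !lerD2r ler_wpM2l ?lef_pV2 ?posrE//.
by rewrite mulr_ge0// divr_ge0// ltW.
Qed.

Lemma weight_gt0 (R : realType) (eta : R) k : eta < 1 -> 0 < weight eta k.
Proof. by move=> eta1; rewrite invr_gt0 exprn_gt0// subr_gt0. Qed.

Lemma telescope (R : realType) (eta c N : R) (T D : nat -> R) K :
  eta < 1 -> (forall k, 0 <= T k) ->
  (forall k, T k.+1 <= (1 - eta) * T k - c * D k + N) ->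
  c * \sum_(k < K.+1) weight eta k * D k <=
    T 0%N + (\sum_(k < K.+1) weight eta k) * N.
Proof.
move=> eta1 T0 step; have e1 : 0 < 1 - eta by rewrite subr_gt0.
(* Keeping the term in [T J] closes the induction: [weight eta J * (1 - eta)] equals
   [(1 - eta) ^- J], so consecutive terms cancel. *)
suff h J : c * \sum_(k < J) weight eta k * D k + (1 - eta) ^- J * T J <=
    T 0%N + (\sum_(k < J) weight eta k) * N.
  by apply: le_trans (h K.+1); rewrite lerDl mulr_ge0// invr_ge0 exprn_ge0// (ltW e1).
elim: J => [|J IH]; first by rewrite !big_ord0 expr0 invr1; lra.
rewrite !big_ord_recr/=.
have := ler_wpM2l (ltW (weight_gt0 J eta1)) (step J).
have E : weight eta J * ((1 - eta) * T J) = (1 - eta) ^- J * T J.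
  by rewrite /weight mulrA exprSr invfM mulrVK// unitfE gt_eqF.
rewrite !mulrDr E -/(weight eta J); lra.
Qed.

(* [w_k >= exp (eta (k + 1))], and the tangent of [exp] at the mean exponent
   [eta (K + 2) / 2] bounds the sum of these below. *)
Lemma sum_weight_ge (R : realType) (eta : R) K : 0 <= eta -> eta < 1 ->
  K.+1%:R * expR (eta * K%:R / 2) <= \sum_(k < K.+1) weight eta k.
Proof.
move=> eta0 eta1; have e1 : 0 < 1 - eta by rewrite subr_gt0.
pose m := eta * (K%:R + 2) / 2.
apply: (@le_trans _ _ (K.+1%:R * expR m)).
  by rewrite ler_pM2l ?ltr0n// ler_expR /m -subr_ge0; lra.
have wk k : expR m * (1 + (eta * k.+1%:R - m)) <= weight eta k.
  apply: (@le_trans _ _ (expR (eta * k.+1%:R))).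
    rewrite (_ : eta * k.+1%:R = m + (eta * k.+1%:R - m)); last by ring.
    rewrite expRD ler_pM2l ?expR_gt0// addrAC subrr add0r.
    exact: expR_ge1Dx.
  rewrite mulr_natr -[eta *+ _]mulr_natl expRM_natl /weight -exprVn.
  rewrite ler_pXn2r ?nnegrE ?expR_ge0 ?invr_ge0 ?(ltW e1)//.
  rewrite -[expR eta]invrK -expRN lef_pV2 ?posrE ?expR_gt0//.
  exact: expR_ge1Dx.
apply: (@le_trans _ _ (\sum_(k < K.+1) expR m * (1 + (eta * k.+1%:R - m)))).
  rewrite -mulr_sumr mulrC ler_pM2l ?expR_gt0//.
  rewrite big_split/= sumr_const card_ord sumrB sumr_const card_ord -mulr_sumr.
  have -> : \sum_(k < K.+1) (k.+1%:R : R) = K.+1%:R * (K%:R + 2) / 2.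
    elim: K {m wk} => [|K IH]; first by rewrite big_ord1 mul1r add0r divff ?pnatr_eq0.
    by rewrite big_ord_recr/= IH -(natr1 K.+1) -(natr1 K); field.
  rewrite -[m *+ _]mulr_natl /m -subr_ge0.
  by rewrite [X in 0 <= X](_ : _ = 0)//; field.
by apply: ler_sum => k _; exact: wk.
Qed.

(** * Second-moment recursion for the virtual iterates *)

Section Moments.
Context {R : realType} {d n : nat} {dO dZ : measure_display}.
Context {Omega : measurableType dO} {Z : measurableType dZ}.
Local Notation V := 'rV[R]_d.
Variables (P : probability Omega R) (Q : probability Z R).
Variables (f : V -> R) (xs : V) (mu L : R).
Hypothesis df : forall y, differentiable f y.
Hypothesis cf : @convex_function R V setT f.
Hypothesis xs_min : unique_minimizer f xs.
Hypotheses (mu0 : 0 <= mu) (fmu : quasi_strongly_convex mu xs f).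
Hypotheses (L0 : 0 <= L) (fL : smooth L f).
Variables (oracle : nat -> 'I_n -> seq V -> Omega -> V)
  (comp : V -> Z -> V) (seed : nat -> 'I_n -> Omega -> Z) (x0 : V) (gamma : R).
Variables (Delta : R) (Past Mid : nat -> set (set Omega)).
Hypothesis n0 : (0 < n)%N.
Hypothesis hC : absolute_compressor Q comp Delta.
Hypothesis hI : information Past Mid.
Hypothesis hfresh : forall k i, fresh_seed P Q (Mid k) (seed k i).
Hypothesis hseed :
  forall k i S, measurable S -> Past k.+1 (seed k i @^-1` S).
Hypothesis gamma0 : 0 < gamma.
Hypothesis mg : forall k i,
  measurable_wrt (Mid k) (sgrad oracle comp seed x0 gamma k i).
Variables (A B C D1 D2 rho F : R) (sigma2 : nat -> Omega -> R).
Hypotheses (A0 : 0 <= A) (C0 : 0 <= C) (D10 : 0 <= D1) (D20 : 0 <= D2).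
Hypotheses (rho0 : 0 < rho) (rho1 : rho <= 1) (F0 : 0 <= F).
Hypothesis BF : B = 3 / 4 * rho * F.
Hypothesis hkey : key_assumption oracle comp seed x0 gamma P Past f xs
  A B C D1 D2 rho sigma2.
Hypothesis iF0 : intg P (fun w => F * sigma2 0%N w).

Local Notation x := (iterate oracle comp seed x0 gamma).
Local Notation gm := (mean_sgrad oracle comp seed x0 gamma).
Local Notation err := (mean_error oracle comp seed x0 gamma).
Local Notation xt := (virtual_iterate oracle comp seed x0 gamma).

Definition gap_at k w := f (x k w) - f xs.

Definition mean_gap k := mean P (gap_at k).
Definition mean_dist k := mean P (fun w => enorm (xt k w - xs) ^+ 2).
Definition mean_noise k := mean P (fun w => F * sigma2 k w).
Definition mean_sgrad2 k := mean P (fun w => enorm (gm k w) ^+ 2).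

Let PastM k : Past k `<=` measurable.
Proof. by have [[]] := hI k. Qed.

Let sPast k : sigma_algebra setT (Past k).
Proof. by have [[]] := hI k. Qed.

Let sM := @sigma_algebra_measurable _ Omega.

Let f_cont : continuous f.
Proof. by move=> y; exact: differentiable_continuous. Qed.

Let err_sq k : sqintg P (err k).
Proof. exact: (mean_error_moment gamma0 hC hI hfresh hseed mg n0 k).1. Qed.

Let mx k : measurable_wrt (Past k) (x k).
Proof. exact: (measurable_iterate hC hI hseed mg k). Qed.

Let mxt k : measurable_wrt (Past k) (xt k).
Proof. exact: (measurable_virtual hC hI hseed mg k). Qed.

Let mgap k : measurable_fun setT (gap_at k).
Proof.
apply: (measurable_wrt_fun (@PastM k)).
have : measurable_wrt (Past k) (f \o x k) by exact: measurable_wrt_continuous.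
move=> mf; apply: measurable_wrtD => //; exact: measurable_wrt_cst.
Qed.

Let sigma_ge0 k w : 0 <= sigma2 k w.
Proof. by have [[_]] := hkey k. Qed.

Section Integrability.
Variable k : nat.
Hypotheses (sxt : sqintg P (xt k)) (hs : intg P (fun w => F * sigma2 k w)).

Let sx_of : sqintg P (x k).
Proof.
have := sqintgD sxt (err_sq k).
by under eq_fun do rewrite /virtual_iterate subrK.
Qed.

Let dist_int : intg P (fun w => enorm (x k w - xs) ^+ 2).
Proof. exact: (sqintgB sx_of (sqintg_cst _ _)).2. Qed.

Let grad_sq_of : sqintg P (fun w => grad f (x k w)).
Proof.
apply: (@sqintg_le _ _ _ _ _ _ (fun w => L ^+ 2 * enorm (x k w - xs) ^+ 2)).
- apply: measurable_wrt_row => // j; apply: (measurable_wrtW (@PastM k)).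
  by have [_ /(_ j)[]] := hkey k.
- exact: intgZ.
- move=> w; rewrite -exprMn ler_pXn2r ?nnegrE ?mulr_ge0 ?enorm_ge0//.
  by have := fL (x k w) xs; rewrite (grad_min df cf xs_min L0 fL) subr0.
Qed.

Let gap_int_of : intg P (gap_at k).
Proof.
apply: intg_dom (mgap k) _ (intgZ L dist_int) => w.
rewrite ger0_norm ?gap_ge0//.
exact: (gap_le df cf xs_min mu0 L0 fL fmu).
Qed.

Let gm_sq_of : sqintg P (gm k) /\
  mean_sgrad2 k <= 2 * A * mean_gap k + 3 / 4 * rho * mean_noise k + D1.
Proof.
have [_ _ hA _] := hkey k.
pose Y w := 2 * A * gap_at k w + 3 / 4 * rho * (F * sigma2 k w) + D1.
have [iY mY] : has_mean P Y
    (2 * A * mean_gap k + 3 / 4 * rho * mean_noise k + D1).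
  apply: has_meanD (has_mean_cst P D1).
  by apply: has_meanD; apply: has_meanZ; exact: intg_has_mean.
have mgm : measurable_wrt measurable (gm k).
  have [_ [sMid MidM] _ _] := hI k.
  exact: measurable_wrtW MidM (measurable_mean_sgrad hI mg k).
have le : (\int[P]_w (enorm (gm k w) ^+ 2)%:E <= (mean P Y)%:E)%E.
  apply: (cond_expectation_le_integral (@PastM k) (sPast k) iY).
  case: hA => Z' cZ leZ; exists Z' => //; apply: filterS leZ => w.
  by rewrite /Y BF mulrA.
have sg : sqintg P (gm k).
  split => //; apply: ge0_intg => [|w|]; [|exact: sqr_ge0|exact: le_lt_trans le (ltry _)].
  by apply/measurable_fun_wrt; exact: measurable_wrt_enorm2.
split => //; rewrite -mY -lee_fin -EFin_mean//; exact: sg.2.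
Qed.

Let noise_of : intg P (fun w => F * sigma2 k.+1 w) /\
  mean_noise k.+1 <= (1 - rho) * mean_noise k + 2 * (C * F) * mean_gap k + F * D2.
Proof.
(* When [F = 0], [sigma2] itself need not be integrable, but every term that contains it
   vanishes. *)
have [F_0|Fn0] := eqVneq F 0.
  rewrite /mean_noise F_0; have z j : (fun w => 0 * sigma2 j w) = fun=> 0.
    by apply/funext => w; rewrite mul0r.
  rewrite !z !mean_cst !(mulr0, mul0r, addr0); split => //; exact: intg_cst.
have Fgt0 : 0 < F by rewrite lt_def Fn0.
have [_ _ _ hA] := hkey k.
have iS : intg P (sigma2 k).
  by apply: eq_intg (intgZ F^-1 hs) => w; rewrite mulKf.
have [iY mY] := has_meanD (has_meanD
  (has_meanZ (1 - rho) (intg_has_mean iS))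
  (has_meanZ (2 * C) (intg_has_mean gap_int_of))) (has_mean_cst P D2).
have le := cond_expectation_le_integral (@PastM k) (sPast k) iY hA.
have isS : intg P (sigma2 k.+1).
  apply: ge0_intg => [||]; [|exact: sigma_ge0|exact: le_lt_trans le (ltry _)].
  by apply: (measurable_wrt_fun (@PastM k.+1)); have [[]] := hkey k.+1.
split; first exact: intgZ.
move: le; rewrite EFin_mean// lee_fin mY => /(ler_wpM2l F0).
rewrite /mean_noise !meanZ// -/(mean_gap k); lra.
Qed.

Let xt_next : sqintg P (xt k.+1).
Proof.
have -> : xt k.+1 = fun w => xt k w - gamma *: gm k w.
  by apply/funext => w; rewrite virtual_iterateS.
by apply: sqintgB => //; apply: sqintgZ; exact: gm_sq_of.1.
Qed.

(** The induction step of [moments_finite], bundled with the facts on iteration [k] that rest on the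
    same integrability. The iterate differs from the virtual one by the mean error, which is
    square-integrable in any case; the gap and the gradient are dominated through the distance to
    [xs]. *)
Lemma moments_step :
  [/\ sqintg P (xt k.+1), intg P (fun w => F * sigma2 k.+1 w),
      sqintg P (x k), intg P (gap_at k) & sqintg P (gm k)] /\
  [/\ mean_sgrad2 k <= 2 * A * mean_gap k + 3 / 4 * rho * mean_noise k + D1,
      mean_noise k.+1 <=
        (1 - rho) * mean_noise k + 2 * (C * F) * mean_gap k + F * D2 &
      sqintg P (fun w => grad f (x k w))].
Proof.
by have [? ?] := gm_sq_of; have [? ?] := noise_of; split; split.
Qed.

End Integrability.

Lemma moments_finite k :
  sqintg P (xt k) /\ intg P (fun w => F * sigma2 k w).
Proof.
elim: k => [|k [IHx IHs]]; last by have [[]] := moments_step IHx IHs.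
split => //; rewrite (_ : xt 0 = fun=> x0); first exact: sqintg_cst.
by apply/funext => w; exact: virtual_iterate0.
Qed.

Let sxt k := (moments_finite k).1.
Let int_noise k := (moments_finite k).2.

Lemma iterate_sq k : sqintg P (x k).
Proof. by have [[]] := moments_step (sxt k) (@int_noise k). Qed.

Lemma gap_int k : intg P (gap_at k).
Proof. by have [[]] := moments_step (sxt k) (@int_noise k). Qed.

Lemma sgrad_sq k : sqintg P (gm k).
Proof. by have [[]] := moments_step (sxt k) (@int_noise k). Qed.

Lemma grad_sq k : sqintg P (fun w => grad f (x k w)).
Proof. by have [_ []] := moments_step (sxt k) (@int_noise k). Qed.

Lemma mean_sgrad2_le k :
  mean_sgrad2 k <= 2 * A * mean_gap k + 3 / 4 * rho * mean_noise k + D1.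
Proof. by have [_ []] := moments_step (sxt k) (@int_noise k). Qed.

Lemma mean_noise_le k : mean_noise k.+1 <=
  (1 - rho) * mean_noise k + 2 * (C * F) * mean_gap k + F * D2.
Proof. by have [_ []] := moments_step (sxt k) (@int_noise k). Qed.

Lemma mean_gap_ge0 k : 0 <= mean_gap k.
Proof. by apply: mean_ge0 => w; exact: gap_ge0. Qed.

Lemma mean_noise_ge0 k : 0 <= mean_noise k.
Proof. by apply: mean_ge0 => w; exact: mulr_ge0. Qed.

Lemma mean_dist_ge0 k : 0 <= mean_dist k.
Proof. by apply: mean_ge0 => w; exact: sqr_ge0. Qed.

Lemma mean_dist0 : mean_dist 0 = enorm (x0 - xs) ^+ 2.
Proof.
by rewrite /mean_dist; under eq_fun do rewrite virtual_iterate0; exact: mean_cst.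
Qed.

Lemma mean_dist_le k : mean_dist k.+1 <= (1 - gamma * mu / 2) * mean_dist k
  - gamma * mean_gap k + 6 * L * gamma * (gamma ^+ 2 * Delta ^+ 2)
  + gamma ^+ 2 * mean_sgrad2 k.
Proof.
have sz : sqintg P (fun w => xt k w - xs) by exact: sqintgB (sqintg_cst _ _).
have hz := intg_has_mean sz.2.
have h1 := intg_has_mean (sqintg_dot sz (sgrad_sq k)).
have h2 := intg_has_mean (sqintg_dot sz (grad_sq k)).
(* The virtual iterate is known before iteration [k], so unbiasedness replaces the stochastic
   gradient by the true one. *)
have e12 : mean P (fun w => dot (xt k w - xs) (gm k w)) =
    mean P (fun w => dot (xt k w - xs) (grad f (x k w))).
  apply: (cond_expectation_dot (G := Past k)) => //.
  - by have [] := hkey k.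
  - by apply: measurable_wrt_vecB => //; exact: measurable_wrt_cst.
  - exact: sgrad_sq.
  - exact: grad_sq.
have hg := intg_has_mean (sgrad_sq k).2.
have vS w : enorm (xt k w - xs) ^+ 2 - 2 * gamma * dot (xt k w - xs) (gm k w)
    + gamma ^+ 2 * enorm (gm k w) ^+ 2 = enorm (xt k.+1 w - xs) ^+ 2.
  rewrite virtual_iterateS (addrAC (xt k w)); move: (xt k w - xs) => z.
  by move: (gm k w) => u; rewrite !enorm2 !dotE (dotC u z); ring.
have [_ E] := eq_has_mean vS (has_meanD (has_meanB hz
  (has_meanZ (2 * gamma) h1)) (has_meanZ (gamma ^+ 2) hg)).
have step w : - (2 * dot (xt k w - xs) (grad f (x k w))) <=
    - gap_at k w - mu / 2 * enorm (xt k w - xs) ^+ 2 + 6 * L * enorm (err k w) ^+ 2.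
  exact: (virtual_step df cf xs_min mu0 L0 fL fmu).
have he := (mean_error_moment gamma0 hC hI hfresh hseed mg n0 k).2.
have := has_mean_le (has_meanN (has_meanZ 2 h2)) (has_meanD (has_meanB
  (has_meanN (intg_has_mean (gap_int k))) (has_meanZ (mu / 2) hz))
  (has_meanZ (6 * L) (intg_has_mean (err_sq k).2))) step.
rewrite -/(mean_gap k) -/(mean_dist k) => /(ler_wpM2l (ltW gamma0)) hs.
have {}he := ler_wpM2l (mulr_ge0 (mulr_ge0 (ler0n R 6) L0) (ltW gamma0)) he.
rewrite {1}/mean_dist E e12 -/(mean_dist k) -/(mean_sgrad2 k).
move: he hs; move: (mean P _) (mean P _) (mean_dist k) (mean_gap k) (mean_sgrad2 k).
by move=> e s r D G; exact: dist_arith.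
Qed.


(* [F] solves [B + (1 - rho) F = (1 - rho / 4) F]. *)
Lemma lyapunov_step eta k :
  gamma <= 1 / (4 * (A + C * F)) -> 0 < A + C * F ->
  eta <= gamma * mu / 2 -> eta <= rho / 4 ->
  mean_dist k.+1 + gamma ^+ 2 * mean_noise k.+1 <=
  (1 - eta) * (mean_dist k + gamma ^+ 2 * mean_noise k)
  - gamma / 2 * mean_gap k
  + (gamma ^+ 2 * (D1 + F * D2) + 6 * L * gamma * (gamma ^+ 2 * Delta ^+ 2)).
Proof.
move=> ga a0 e1 e2.
apply: (lyapunov_arith (ltW gamma0) ga a0 e1 e2 (mean_gap_ge0 k)
  (mean_dist_ge0 k) (mean_noise_ge0 k) (mean_dist_le k) (mean_sgrad2_le k)
  (mean_noise_le k)).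
Qed.

Local Notation xbar := (weighted_iterate oracle comp seed x0 gamma).

Lemma weighted_gap_measurable eta K :
  measurable_fun setT (fun w => f (xbar eta K w) - f xs).
Proof.
apply/measurable_fun_wrt; apply: measurable_wrtD => //; last exact: measurable_wrt_cst.
apply: (measurable_wrt_continuous f_cont (X := xbar eta K)).
apply: measurable_wrt_vecZ => //; apply: measurable_wrt_vec_sum => // k.
by apply: measurable_wrt_vecZ => //; exact: measurable_wrtW (@PastM k) (mx k).
Qed.

(** One bound serves both regimes: [eta = 0] leaves the decay [1 / K.+1], and [eta > 0] adds the
    exponential. *)
Lemma weighted_gap_bound eta K :
  gamma <= 1 / (4 * (A + C * F)) -> 0 < A + C * F ->
  0 <= eta -> eta <= gamma * mu / 2 -> eta <= rho / 4 ->
  intg P (fun w => f (xbar eta K w) - f xs) /\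
  mean P (fun w => f (xbar eta K w) - f xs) <=
    2 / gamma * (enorm (x0 - xs) ^+ 2 + gamma ^+ 2 * mean_noise 0)
      / (K.+1%:R * expR (eta * K%:R / 2))
    + 2 * gamma * (D1 + F * D2) + 12 * L * gamma ^+ 2 * Delta ^+ 2.
Proof.
move=> ga a0 eta0 e1 e2.
have eta1 : eta < 1.
  by apply: le_lt_trans e2 _; rewrite ltr_pdivrMr// mul1r (le_lt_trans rho1)// ltr1n.
set W := \sum_(k < K.+1) weight eta k.
have W0 : 0 < W.
  apply: lt_le_trans (sum_weight_ge K eta0 eta1).
  by rewrite mulr_gt0 ?expR_gt0.
have hS := has_mean_sum (fun k : 'I_K.+1 =>
  has_meanZ (weight eta k) (intg_has_mean (gap_int k))).
have jen w : f (xbar eta K w) - f xs <=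
    W^-1 * \sum_(k < K.+1) weight eta k * gap_at k w.
  rewrite mulrC ler_pdivlMr// mulrC mulrBr.
  apply: le_trans (lerB (jensen df cf (fun k : 'I_K.+1 => x k w)
    (fun k => weight_gt0 k eta1)) (lexx _)) _.
  by rewrite /W mulr_suml -sumrB; apply: ler_sum => k _; rewrite mulrBr.
have ig : intg P (fun w => f (xbar eta K w) - f xs).
  apply: intg_dom (has_meanZ W^-1 hS).1; first exact: weighted_gap_measurable.
  by move=> w; rewrite ger0_norm// gap_ge0.
split => //.
have := has_mean_le (intg_has_mean ig) (has_meanZ W^-1 hS) jen.
have := telescope (T := fun k => mean_dist k + gamma ^+ 2 * mean_noise k)
  K eta1 _ (fun k => lyapunov_step k ga a0 e1 e2).
rewrite -/W mean_dist0; set S := \sum_(k < _) _ => h1 h2.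
apply: le_trans h2 _.
rewrite [12 * L * _ * _](_ : _ = 12 * (L * Delta ^+ 2) * gamma ^+ 2); last by ring.
apply: (weighted_arith gamma0 W0 (sum_weight_ge K eta0 eta1) _ _ _ (h1 _)).
- by rewrite mulr_gt0 ?expR_gt0.
- exact: addr_ge0 (sqr_ge0 _) (mulr_ge0 (sqr_ge0 _) (mean_noise_ge0 _)).
- by ring.
- by move=> k; exact: addr_ge0 (mean_dist_ge0 k)
    (mulr_ge0 (sqr_ge0 _) (mean_noise_ge0 k)).
Qed.

(** Quasi-strong convexity at the true iterate, unbiasedness, and Young's inequality with weight
    [mu / 2]. No stepsize appears, which is what makes the later moment bounds uniform in
    [gamma]. *)
Lemma mean_sqdist_le k : 0 < mu ->
  mean_gap k + mu / 4 * mean P (fun w => enorm (x k w - xs) ^+ 2) <=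
  mu^-1 * mean_sgrad2 k.
Proof.
move=> mu_gt0.
have sz : sqintg P (fun w => x k w - xs) := sqintgB (iterate_sq k) (sqintg_cst P xs).
have hz := intg_has_mean sz.2.
have h1 := intg_has_mean (sqintg_dot sz (sgrad_sq k)).
have h2 := intg_has_mean (sqintg_dot sz (grad_sq k)).
have hg := intg_has_mean (sgrad_sq k).2.
have e12 : mean P (fun w => dot (x k w - xs) (gm k w)) =
    mean P (fun w => dot (x k w - xs) (grad f (x k w))).
  apply: (cond_expectation_dot (G := Past k)) => //.
  - by have [] := hkey k.
  - by apply: measurable_wrt_vecB => //; exact: measurable_wrt_cst.
  - exact: sgrad_sq.
  - exact: grad_sq.
have step1 w : gap_at k w + mu / 2 * enorm (x k w - xs) ^+ 2 <=
    dot (x k w - xs) (grad f (x k w)).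
  by rewrite dotC; exact: qsc_dot.
have step2 w : dot (x k w - xs) (gm k w) <=
    mu / 4 * enorm (x k w - xs) ^+ 2 + mu^-1 * enorm (gm k w) ^+ 2.
  have c0 : 0 < mu / 2 by rewrite divr_gt0.
  have := dot2_le (x k w - xs) (gm k w) c0.
  rewrite -!enorm2 invf_div; move: (dot _ _) (enorm _ ^+ 2) (enorm _ ^+ 2).
  by move=> s u v; lra.
have h3 := has_mean_le (has_meanD (intg_has_mean (gap_int k))
  (has_meanZ (mu / 2) hz)) h2 step1.
have h4 := has_mean_le h1 (has_meanD (has_meanZ (mu / 4) hz)
  (has_meanZ mu^-1 hg)) step2.
rewrite e12 in h4; move: (le_trans h3 h4).
rewrite -/(mean_gap k) -/(mean_sgrad2 k).
by move: (mean P _) (mean_gap k) (mean_sgrad2 k) => u v t; lra.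
Qed.

End Moments.

(** * Large curvature *)

Section MeanAe.
Context {R : realType} {dO : measure_display} {Omega : measurableType dO}.
Variable P : probability Omega R.
Implicit Types (X Y : Omega -> R).

Lemma mean_le_ae X Y : intg P X -> intg P Y ->
  {ae P, forall w, X w <= Y w} -> mean P X <= mean P Y.
Proof.
move=> iX iY XY; rewrite -lee_fin -!EFin_mean//.
by apply: ae_le_integral => //; [exact: intg_meas iX|exact: intg_meas iY].
Qed.

Lemma mean_ae_cst X c : intg P X -> {ae P, forall w, X w = c} -> mean P X = c.
Proof.
move=> iX Xc; apply/eqP; rewrite eq_le -{1 2}(mean_cst P c).
by apply/andP; split; apply: mean_le_ae => //;
  do ?[exact: intg_cst]; apply: filterS Xc => w ->.
Qed.

Lemma ae_eq0_mean X : intg P X -> (forall w, 0 <= X w) -> mean P X <= 0 ->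
  {ae P, forall w, X w = 0}.
Proof.
move=> iX X0 mX.
have : (\int[P]_w `|(X w)%:E| = 0)%E.
  under eq_integral do rewrite gee0_abs ?lee_fin//.
  by rewrite EFin_mean//; congr EFin; apply/eqP; rewrite eq_le mX mean_ge0.
move=> /(ae_eq_integral_abs _ measurableT (measurable_int _ iX)).
by apply: filterS => w /(_ I)/= [].
Qed.

End MeanAe.

(** Chaining the bounds on [G] and using [4 * A <= mu] to absorb [2 * A * D] into half of [mu * D]
    leaves [mu / 2 * D + mu ^+ 2 / 4 * q <= M + D1]; both conclusions follow. *)
Lemma bounded_noise_arith (R : realType) (rho A C F mu s D q G D1 D2 M s' : R) :
  0 < mu -> 0 <= A -> 0 <= C -> 0 <= F -> 0 < rho -> rho <= 1 ->
  4 * A <= mu -> 0 <= D -> 0 <= q -> 0 <= s -> s <= M ->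
  D + mu / 4 * q <= mu^-1 * G ->
  G <= 2 * A * D + 3 / 4 * rho * s + D1 ->
  s' <= (1 - rho) * s + 2 * (C * F) * D + F * D2 ->
  q <= 4 / mu ^+ 2 * (M + D1) /\
  s' <= M + 2 * (C * F) * (2 / mu * (M + D1)) + F * D2.
Proof.
move=> mu0 A0 C0 F0 r0 r1 Amu D0 q0 s0 sM h1 h2 h3.
have m2 : 0 < mu ^+ 2 by rewrite exprn_gt0.
have CF : 0 <= 2 * (C * F) by rewrite !mulr_ge0.
have rs : rho * s <= M by apply: le_trans sM; rewrite ler_piMl.
have {}h1 : mu * D + mu ^+ 2 / 4 * q <= G.
  have := ler_wpM2l (ltW mu0) h1; rewrite mulVKf ?gt_eqF//; lra.
have {}Amu := ler_wpM2r D0 Amu.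
have key : mu / 2 * D + mu ^+ 2 / 4 * q <= M + D1 by lra.
have q' : 0 <= mu ^+ 2 / 4 * q by rewrite mulr_ge0// divr_ge0// ltW.
have D' : 0 <= mu / 2 * D by rewrite mulr_ge0// divr_ge0// ltW.
split.
  rewrite -(ler_pM2l (_ : 0 < mu ^+ 2 / 4)) ?divr_gt0//.
  rewrite [leRHS](_ : _ = M + D1); last by field; rewrite gt_eqF.
  lra.
have hD : D <= 2 / mu * (M + D1).
  rewrite -(ler_pM2l (_ : 0 < mu / 2)) ?divr_gt0//.
  rewrite [leRHS](_ : _ = M + D1); last by field; rewrite gt_eqF.
  lra.
have := ler_wpM2l CF hD; have := mulr_ge0 (ltW r0) s0; lra.
Qed.

Lemma sqr_dominated_le0 (R : realType) (m N : R) :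
  (forall g, 0 < g -> g ^+ 2 * m <= N) -> m <= 0.
Proof.
move=> bnd; rewrite leNgt; apply/negP => m0.
have N0 : 0 < N by apply: lt_le_trans (bnd 1 ltr01); rewrite expr1n mul1r.
have := bnd (1 + N / m); rewrite addr_gt0 ?divr_gt0// => /(_ isT).
have Nm : 0 < N / m by rewrite divr_gt0.
have E : N / m * m = N by rewrite divfK ?gt_eqF.
by rewrite leNgt => /negP; apply; nra.
Qed.

(** The order of choices matters: [g] is fixed first, making the noise terms at most [delta / 4];
    then [J] makes the initial term, which may be large for small [g], less than [delta / 2]. *)
Lemma vanishing_arith (R : realType) (a L e2 D r s delta : R) :
  0 < a -> 0 <= L -> 0 <= D ->
  (forall g J, 0 < g -> g <= 1 / (4 * a) ->
    delta <= 2 / g * (r + g ^+ 2 * s) / J.+1%:R + 2 * g * D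
      + 12 * L * g ^+ 2 * e2 ^+ 2) ->
  delta <= 0.
Proof.
move=> a0 L0 D0 bnd; rewrite leNgt; apply/negP => d0.
pose q := 2 * D + 12 * L * e2 ^+ 2.
have q0 : 0 <= q := addr_ge0 (mulr_ge0 (ler0n R 2) D0)
  (mulr_ge0 (mulr_ge0 (ler0n R 12) L0) (sqr_ge0 e2)).
pose g := Num.min (1 / (4 * a)) (Num.min 1 (delta / 4 / (q + 1))).
have q1 : 0 < q + 1 by rewrite ltr_wpDl.
have g0 : 0 < g by rewrite !lt_min !divr_gt0 ?mulr_gt0// ltr01.
have ga : g <= 1 / (4 * a) by rewrite ge_min lexx.
have g1 : g <= 1 by rewrite !ge_min lexx /= orbT.
have gq : g * (q + 1) <= delta / 4.
  by rewrite -ler_pdivlMr// !ge_min lexx !orbT.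
pose c := 2 / g * (r + g ^+ 2 * s).
have [J] : exists J : nat, c / J.+1%:R < delta / 2.
  pose y := `|c| / (delta / 2).
  have y0 : 0 <= y by rewrite divr_ge0// ltW// divr_gt0.
  exists (Num.bound y); rewrite ltr_pdivrMr ?ltr0n// mulrC.
  rewrite -ltr_pdivrMr ?divr_gt0//.
  have hJ : y < (Num.bound y).+1%:R.
    by apply: lt_trans (archi_boundP y0) _; rewrite ltr_nat.
  apply: le_lt_trans hJ.
  by rewrite ler_pM2r ?invr_gt0 ?divr_gt0// ler_norm.
move=> hJ; have := bnd g J g0 ga; rewrite -/c.
have gg : g ^+ 2 <= g by rewrite expr2 ler_piMl ?(ltW g0).
have := ler_wpM2l (mulr_ge0 (mulr_ge0 (ler0n R 12) L0) (sqr_ge0 e2)) gg.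
move: gq hJ; rewrite /q; move: (c / _) (g ^+ 2) => y g2; nra.
Qed.

Section LargeCurvature.
Context {R : realType} {d n : nat} {dO dZ : measure_display}.
Context {Omega : measurableType dO} {Z : measurableType dZ}.
Local Notation V := 'rV[R]_d.
Variables (P : probability Omega R) (Q : probability Z R).
Variables (f : V -> R) (xs : V) (mu L : R).
Hypothesis df : forall y, differentiable f y.
Hypothesis cf : @convex_function R V setT f.
Hypothesis xs_min : unique_minimizer f xs.
Hypotheses (mu0 : 0 < mu) (fmu : quasi_strongly_convex mu xs f).
Hypotheses (L0 : 0 <= L) (fL : smooth L f).
Variables (oracle : nat -> 'I_n -> seq V -> Omega -> V)
  (comp : V -> Z -> V) (seed : nat -> 'I_n -> Omega -> Z) (x0 : V).
Variables (Delta : R) (Past Mid : nat -> set (set Omega)).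
Hypothesis n0 : (0 < n)%N.
Hypothesis hC : absolute_compressor Q comp Delta.
Hypothesis hI : information Past Mid.
Hypothesis hfresh : forall k i, fresh_seed P Q (Mid k) (seed k i).
Hypothesis hseed :
  forall k i S, measurable S -> Past k.+1 (seed k i @^-1` S).
Variables (A B C D1 D2 rho F : R).
Variables (sigma2 : R -> nat -> Omega -> R) (sigma20 : Omega -> R).
Hypotheses (A0 : 0 <= A) (C0 : 0 <= C) (D10 : 0 <= D1) (D20 : 0 <= D2).
Hypotheses (rho0 : 0 < rho) (rho1 : rho <= 1) (F0 : 0 <= F).
Hypothesis BF : B = 3 / 4 * rho * F.
Hypothesis hrun : forall gamma : R, 0 < gamma ->
  [/\ forall k i, measurable_wrt (Mid k)
                    (sgrad oracle comp seed x0 gamma k i),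
      sigma2 gamma 0%N = sigma20 &
      key_assumption oracle comp seed x0 gamma P Past f xs
        A B C D1 D2 rho (sigma2 gamma)].
Hypothesis iF0 : intg P (fun w => F * sigma20 w).
Hypothesis A_mu : 4 * A <= mu.

Local Notation x := (iterate oracle comp seed x0).
Local Notation hist gamma k w := (ecsgd oracle comp seed x0 gamma k w).1.
Local Notation err := (local_error oracle comp seed x0).
Local Notation msg := (message oracle comp seed x0).

Let mg gamma : 0 < gamma -> forall k i, measurable_wrt (Mid k)
  (sgrad oracle comp seed x0 gamma k i).
Proof. by case/hrun. Qed.

Let hkey gamma : 0 < gamma -> key_assumption oracle comp seed x0 gamma P Past f xs
  A B C D1 D2 rho (sigma2 gamma).
Proof. by case/hrun. Qed.

Let iF gamma : 0 < gamma -> intg P (fun w => F * sigma2 gamma 0%N w).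
Proof. by case/hrun => _ ->. Qed.

Let sq gamma (g0 : 0 < gamma) := iterate_sq df cf xs_min (ltW mu0) fmu L0 fL n0 hC
  hI hfresh hseed g0 (mg g0) F0 BF (hkey g0) (iF g0).

Let q_int gamma k (g0 : 0 < gamma) :
  intg P (fun w => enorm (x gamma k w - xs) ^+ 2) :=
  (sqintgB (sq g0 k) (sqintg_cst P xs)).2.

Lemma moments_bounded_step k M :
  (forall gamma, 0 < gamma -> mean_noise P F (sigma2 gamma) k <= M) ->
  forall gamma, 0 < gamma ->
    mean P (fun w => enorm (x gamma k w - xs) ^+ 2) <= 4 / mu ^+ 2 * (M + D1) /\
    mean_noise P F (sigma2 gamma) k.+1 <=
      M + 2 * (C * F) * (2 / mu * (M + D1)) + F * D2.
Proof.
move=> bnd gamma g0.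
have h1 := mean_sqdist_le df cf xs_min (ltW mu0) fmu L0 fL n0 hC
  hI hfresh hseed g0 (mg g0) F0 BF (hkey g0) (iF g0) k mu0.
have h2 := mean_sgrad2_le df cf xs_min (ltW mu0) fmu L0 fL n0 hC
  hI hfresh hseed g0 (mg g0) F0 BF (hkey g0) (iF g0) k.
have h3 := mean_noise_le df cf xs_min (ltW mu0) fmu L0 fL n0 hC
  hI hfresh hseed g0 (mg g0) F0 BF (hkey g0) (iF g0) k.
apply: (bounded_noise_arith mu0 A0 C0 F0 rho0 rho1 A_mu _ _ _ (bnd _ g0) h1 h2 h3).
- by apply: mean_ge0 => w; exact: gap_ge0.
- by apply: mean_ge0 => w; exact: sqr_ge0.
- by apply: mean_ge0 => w; rewrite mulr_ge0//; have [[_]] := hkey g0 k.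
Qed.

Lemma moments_bounded k : exists M, forall gamma, 0 < gamma ->
  mean_noise P F (sigma2 gamma) k <= M.
Proof.
elim: k => [|k [M IH]].
  (* The initial noise is common to all stepsizes. *)
  exists (mean P (fun w => F * sigma20 w)) => gamma g0.
  by rewrite /mean_noise; have [_ -> _] := hrun g0.
exists (M + 2 * (C * F) * (2 / mu * (M + D1)) + F * D2) => gamma g0.
by have [] := moments_bounded_step IH g0.
Qed.

Lemma mean_sqdist_bounded k : exists M, forall gamma, 0 < gamma ->
  mean P (fun w => enorm (x gamma k w - xs) ^+ 2) <= M.
Proof.
have [M bnd] := moments_bounded k.
exists (4 / mu ^+ 2 * (M + D1)) => gamma g0.
by have [] := moments_bounded_step bnd g0.
Qed.

(* As long as the iterates have not moved, the messages do not depend on the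
   stepsize, so the next move is proportional to [gamma]; it vanishes because the
   second moments are bounded uniformly in [gamma]. *)
Lemma iterates_constant k gamma : 0 < gamma -> {ae P, forall w,
  hist gamma k w = nseq k.+1 x0 /\ (forall i, err gamma k i w = gamma *: err 1 k i w)}.
Proof.
elim: k gamma => [|k IH] gamma g0.
  by apply: aeW => w; split => // i; rewrite scaler0.
(* The move at stepsize 1, to which the move at stepsize [g] is proportional. The scaling of the
   local errors is part of the induction because it makes the messages independent of [g]. *)
pose u w := x0 - x 1 k.+1 w.
have step g : 0 < g -> {ae P, forall w, x g k.+1 w = x0 - g *: u w /\
    (forall i, err g k.+1 i w = g *: err 1 k.+1 i w)}.
  move=> gg0; apply: filterS2 (IH _ gg0) (IH _ ltr01) => w [hg eg] [h1 e1].
  have sg i : sgrad oracle comp seed x0 g k i w = sgrad oracle comp seed x0 1 k i w.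
    by rewrite /sgrad hg h1.
  have mm i : msg g k i w = msg 1 k i w.
    by rewrite /message sg eg invr1 !scale1r -scalerDr scalerA mulVf ?gt_eqF// scale1r.
  split; last first.
    by move=> i; rewrite !local_errorS mm sg eg !scale1r scalerBr scalerDr.
  rewrite /u !iterateS /iterate hg h1 /= subKr.
  rewrite scalerA mulrC -scalerA; congr (_ - _ *: _); rewrite scaler_sumr.
  by apply: eq_bigr => i _; rewrite mm scale1r.
have su : sqintg P u by exact: sqintgB (sqintg_cst _ _) (sq ltr01 _).
have u0 : {ae P, forall w, enorm (u w) ^+ 2 = 0}.
  apply: (ae_eq0_mean su.2) => [w|]; first exact: sqr_ge0.
  have [M hM] := mean_sqdist_bounded k.+1.
  pose N := 2 * enorm (x0 - xs) ^+ 2 + 2 * M.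
  have bnd g : 0 < g -> g ^+ 2 * mean P (fun w => enorm (u w) ^+ 2) <= N.
    move=> gg0.
    have [i2 m2] := has_meanD (has_mean_cst P (2 * enorm (x0 - xs) ^+ 2))
      (has_meanZ 2 (intg_has_mean (q_int k.+1 gg0))).
    rewrite -meanZ; last exact: su.2.
    apply: (@le_trans _ _ (2 * enorm (x0 - xs) ^+ 2 +
      2 * mean P (fun w => enorm (x g k.+1 w - xs) ^+ 2))); last first.
      by rewrite lerD2l ler_pM2l// hM.
    rewrite -m2; apply: mean_le_ae => //; first exact: intgZ su.2.
    apply: filterS (step _ gg0) => w [-> _].
    have := enorm2D_le (x0 - xs) (- (x0 - g *: u w - xs)).
    rewrite (_ : x0 - xs - (x0 - g *: u w - xs) = g *: u w); last first.
      by rewrite opprB addrA subrK opprB addrC subrK.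
    by rewrite enorm2 dotZl dotZr -enorm2 mulrA -expr2 (enorm2 (- _)) dotNl dotNr
      opprK -enorm2.
  exact: sqr_dominated_le0 bnd.
apply: filterS3 (IH _ g0) (step _ g0) u0 => w [hg _] [xg eg] /enorm2_eq0 u0.
by split => //; rewrite historyS hg xg u0 scaler0 subr0.
Qed.

Lemma weighted_iterate_constant gamma eta K : 0 < gamma -> eta < 1 ->
  {ae P, forall w, weighted_iterate oracle comp seed x0 gamma eta K w = x0}.
Proof.
move=> g0 eta1.
have := ae_foralln (fun k => iterates_constant k g0).
apply: filterS => w hw; rewrite /weighted_iterate.
have -> : \sum_(k < K.+1) weight eta k *: x gamma k w =
    \sum_(k < K.+1) weight eta k *: x0.
  by apply: eq_bigr => k _; rewrite /iterate (hw k).1.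
rewrite -scaler_suml scalerA mulVf ?scale1r// gt_eqF//.
rewrite big_ord_recl ltr_pwDl ?weight_gt0//.
by apply: sumr_ge0 => k _; rewrite ltW// weight_gt0.
Qed.

Lemma large_curvature_gap gamma eta K : 0 < A + C * F ->
  0 < gamma -> eta < 1 ->
  (\int[P]_w (f (weighted_iterate oracle comp seed x0 gamma eta K w) - f xs)%:E <= 0)%E.
Proof.
move=> a0 g0 eta1.
suff fx0 : f x0 - f xs <= 0.
  apply: (@le_trans _ _ (\int[P]_w (0 : R)%:E)%E); last by rewrite integral0.
  apply: ae_le_integral => //.
    exact: (weighted_gap_measurable xs df hC hI hseed (mg g0)).
  by apply: filterS (weighted_iterate_constant K g0 eta1) => w ->.
set delta := f x0 - f xs.
(* On a constant run the mean gap is [delta] for every stepsize and horizon. Taking [eta = 0] leaves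
   a plain average over [J.+1] iterates. *)
have bnd g J : 0 < g -> g <= 1 / (4 * (A + C * F)) ->
    delta <= 2 / g * (enorm (x0 - xs) ^+ 2 + g ^+ 2 * mean P (fun w => F * sigma20 w))
      / J.+1%:R + 2 * g * (D1 + F * D2) + 12 * L * g ^+ 2 * Delta ^+ 2.
  move=> gg0 ga.
  have [|||i le] := weighted_gap_bound df cf xs_min (ltW mu0) fmu L0 fL n0 hC
    hI hfresh hseed gg0 (mg gg0) rho1 F0 BF (hkey gg0) (iF gg0) (eta := 0) J ga a0.
  - by [].
  - by rewrite divr_ge0// mulr_ge0 ?ltW.
  - by rewrite divr_ge0 ?ltW.
  move: le; rewrite (mean_ae_cst (c := delta) i); last first.
    by apply: filterS (weighted_iterate_constant J gg0 ltr01) => w ->.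
  rewrite /mean_noise; have [_ -> _] := hrun gg0.
  by rewrite !mul0r expR0 mulr1.
exact: vanishing_arith a0 L0 (addr_ge0 D10 (mulr_ge0 F0 D20)) bnd.
Qed.

End LargeCurvature.

(** * Choice of the stepsize *)

Section ConvexStepsize.
Context {R : realType}.

Lemma powR3 (y : R) m : 0 <= y -> (y `^ (1 / 3)) ^+ m = y `^ (m%:R / 3).
Proof.
move=> y0; rewrite -powR_mulrn ?powR_ge0// -powRrM; congr (_ `^ _).
by rewrite mulrC mulrA mulr1.
Qed.

(* [1 / gamma] is the sum of the four inverse stepsizes that balance
   [R0 ^ 2 / (gamma K)] with each of the other terms. *)
Lemma convex_stepsize (a r K s D L e B2 : R) :
  0 < a -> 0 < r -> 0 < K -> 0 <= s -> 0 <= D -> 0 <= L -> 0 <= e ->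
  0 <= B2 -> s <= 4 * B2 ^+ 2 ->
  exists gamma, [/\ 0 < gamma, gamma <= 1 / (4 * a) &
    2 / gamma * (r ^+ 2 + gamma ^+ 2 * s) / K + 2 * gamma * D
      + 12 * L * gamma ^+ 2 * e ^+ 2 <=
    14 * (a * r ^+ 2 / K + r / K * B2 + Num.sqrt (r ^+ 2 * D / K)
      + L `^ (1 / 3) * r `^ (4 / 3) * e `^ (2 / 3) / K `^ (2 / 3))].
Proof.
move=> a0 r0 K0 s0 D0 L0 e0 B0 sB.
(* In terms of cube roots the fractional powers become integer powers, and the balancing identities
   become field identities. *)
pose l := L `^ (1 / 3); pose u := r `^ (1 / 3); pose v := e `^ (1 / 3).
pose k := K `^ (1 / 3).
have l0 : 0 <= l by exact: powR_ge0.
have u0 : 0 < u by exact: powR_gt0.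
have v0 : 0 <= v by exact: powR_ge0.
have k0 : 0 < k by exact: powR_gt0.
have P : L `^ (1 / 3) * r `^ (4 / 3) * e `^ (2 / 3) / K `^ (2 / 3) =
    l * u ^+ 4 * v ^+ 2 / k ^+ 2.
  by rewrite /l /u /v /k !powR3 ?(ltW r0) ?(ltW K0).
have third : 3%:R / 3 = 1 :> R by rewrite divff.
have Le : L = l ^+ 3 by rewrite /l powR3// third powRr1.
have re : r = u ^+ 3 by rewrite /u powR3 ?third ?powRr1 ?(ltW r0) ?(ltW K0).
have ee : e = v ^+ 3 by rewrite /v powR3// third powRr1.
have Ke : K = k ^+ 3 by rewrite /k powR3 ?third ?powRr1 ?(ltW r0) ?(ltW K0).
(* The inverse stepsize that balances the initial term with compression:
   [t ^+ 3 = L * e ^+ 2 * K / r ^+ 2]. *)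
pose t := l * v ^+ 2 * k / u ^+ 2.
have t0 : 0 <= t by rewrite /t divr_ge0 ?mulr_ge0 ?exprn_ge0 ?(ltW u0) ?(ltW k0).
have tP : l * u ^+ 4 * v ^+ 2 / k ^+ 2 = r ^+ 2 * t / K.
  by rewrite /t re Ke; field; rewrite !gt_eqF.
have t3 : L * e ^+ 2 = t ^+ 3 * r ^+ 2 / K.
  by rewrite /t Le re ee Ke; field; rewrite !gt_eqF.
(* The inverse stepsize [h / r] balances the initial term with the gradient noise. *)
pose h := Num.sqrt (D * K).
have h0 : 0 <= h by exact: sqrtr_ge0.
have h2 : D = h ^+ 2 / K by rewrite sqr_sqrtr ?mulr_ge0 ?(ltW K0)// mulfK ?gt_eqF.
have hP : Num.sqrt (r ^+ 2 * D / K) = r * h / K.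
  have -> : r ^+ 2 * D / K = (r * h / K) ^+ 2.
    by rewrite {1}h2; field; rewrite gt_eqF.
  by rewrite sqrtr_sqr ger0_norm// divr_ge0 ?mulr_ge0 ?(ltW r0) ?(ltW K0).
rewrite P tP hP.
pose q := 4 * a + 2 * B2 / r + h / r + t.
have q1 : 0 <= 2 * B2 / r by rewrite divr_ge0 ?mulr_ge0 ?(ltW r0).
have q2 : 0 <= h / r by rewrite divr_ge0 ?(ltW r0).
have q0 : 0 < q by rewrite /q; lra.
have qa : 4 * a <= q by rewrite /q; lra.
have qB : 2 * B2 / r <= q by rewrite /q; lra.
have qh : h / r <= q by rewrite /q; lra.
have qt : t <= q by rewrite /q; lra.
exists q^-1; split; first by rewrite invr_gt0.
  by rewrite div1r lef_pV2 ?posrE ?mulr_gt0.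
rewrite invrK (_ : 12 * L * _ * _ = 12 * (q^-1 ^+ 2 * (L * e ^+ 2))); last by ring.
have g0 : 0 < q^-1 by rewrite invr_gt0.
have inv y : y <= q -> q^-1 * y <= 1 by move=> yq; rewrite mulrC ler_pdivrMr// mul1r.
have gB : q^-1 * (2 * B2) <= r.
  by have := inv _ qB; rewrite mulrA ler_pdivrMr// mul1r.
have gh : q^-1 * h <= r by have := inv _ qh; rewrite mulrA ler_pdivrMr// mul1r.
have gt := inv _ qt.
have i1 : q^-1 * s <= r * (2 * B2).
  apply: (@le_trans _ _ (q^-1 * (2 * B2) * (2 * B2))).
    rewrite -mulrA ler_pM2l//; apply: le_trans sB _.
    by rewrite -subr_ge0 [leRHS](_ : _ = 0)//; ring.
  by rewrite ler_wpM2r// mulr_ge0.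
have i2 : q^-1 * D <= r * h / K.
  rewrite h2 mulrA ler_pM2r ?invr_gt0// expr2 mulrA.
  by rewrite ler_wpM2r.
have i3 : q^-1 ^+ 2 * (L * e ^+ 2) <= r ^+ 2 * t / K.
  rewrite t3 mulrA ler_pM2r ?invr_gt0// (mulrC (r ^+ 2)) mulrA.
  rewrite ler_wpM2r ?sqr_ge0//.
  rewrite [leLHS](_ : _ = (q^-1 * t) ^+ 2 * t); last by ring.
  by rewrite ler_piMl// expr_le1// mulr_ge0// ltW.
have -> : 2 * q * (r ^+ 2 + q^-1 ^+ 2 * s) / K =
   (2 * q * r ^+ 2 + 2 * (q^-1 * s)) / K by field; rewrite !gt_eqF.
have -> : 2 * q * r ^+ 2 = 8 * (a * r ^+ 2) + 4 * r * B2 + 2 * (r * h) + 2 * (r ^+ 2 * t).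
  by rewrite /q; field; rewrite gt_eqF.
have {}i1 : (8 * (a * r ^+ 2) + 4 * r * B2 + 2 * (r * h) + 2 * (r ^+ 2 * t) +
   2 * (q^-1 * s)) / K <= (8 * (a * r ^+ 2) + 8 * (r * B2) + 2 * (r * h)
     + 2 * (r ^+ 2 * t)) / K.
  by rewrite ler_pM2r ?invr_gt0//; lra.
have j1 : 0 <= a * r ^+ 2 / K by exact: divr_ge0 (mulr_ge0 (ltW a0) (sqr_ge0 r)) (ltW K0).
have j2 : 0 <= r * B2 / K := divr_ge0 (mulr_ge0 (ltW r0) B0) (ltW K0).
have j3 : 0 <= r * h / K := divr_ge0 (mulr_ge0 (ltW r0) h0) (ltW K0).
have -> : r / K * B2 = r * B2 / K by rewrite mulrAC.
have j4 : 0 <= r ^+ 2 * t / K := divr_ge0 (mulr_ge0 (sqr_ge0 r) t0) (ltW K0).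
apply: le_trans (lerD (lerD i1 (lexx _)) (lexx _)) _.
(* The four terms end up with the factors 8, 8, 4 and 14, the last being 2 from the initial term and
   12 from compression. *)
rewrite [X in X + _ + _](_ : _ = 8 * (a * r ^+ 2 / K) + 8 * (r * B2 / K)
  + 2 * (r * h / K) + 2 * (r ^+ 2 * t / K)); last by ring.
rewrite -(mulrA 2 q^-1 D).
move: i2 i3 j1 j2 j3 j4; move: (q^-1 * D) (q^-1 ^+ 2 * _) => y z.
move: (r ^+ 2 * t / K) (r * h / K) (r * B2 / K) (a * r ^+ 2 / K).
by move=> ? ? ? ? *; lra.
Qed.

End ConvexStepsize.

Section StronglyConvexStepsize.
Context {R : realType}.

(* The stepsize is the minimum of [1 / (4 a)] and [68 l / (mu K)], or [1 / (4 a)]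
   when there is neither noise nor compression error. *)
Lemma curved_stepsize (a mu rho K T D E l : R) :
  0 < a -> 0 < mu -> mu <= 4 * a -> 0 < rho -> 1 <= K ->
  0 <= T -> 0 <= D -> 0 <= E -> 1 <= l ->
  (D = 0 /\ E = 0) \/
    2 * mu * T * expR (- (17 * l)) <= D / (mu * K) + E / (mu ^+ 2 * K ^+ 2) ->
  exists gamma, [/\ 0 < gamma, gamma <= 1 / (4 * a) &
    2 / gamma * T / ((K + 1) * expR (Num.min (gamma * mu / 2) (rho / 4) * K / 2))
      + 2 * gamma * D + 12 * E * gamma ^+ 2 <=
    (12 * 68 ^+ 2 + 8) * l ^+ 2 * (a * T * expR (- (1 / 16 * Num.min (mu / a) rho * K))
      + D / (mu * K) + E / (mu ^+ 2 * K ^+ 2))].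
Proof.
move=> a0 mu0 mua r0 K1 T0 D0 E0 l1 tail.
have K0 : 0 < K by apply: lt_le_trans K1.
have l0 : 0 < l by apply: lt_le_trans l1.
have l2 : 1 <= l ^+ 2 by rewrite exprn_ege1.
have ll2 : l <= l ^+ 2 by rewrite expr2 ler_peMr// ltW.
set X := a * T * _; set Y := D / _; set W := E / _.
have X0 : 0 <= X by rewrite !mulr_ge0 ?expR_ge0 ?(ltW a0).
have Y0 : 0 <= Y by rewrite divr_ge0 ?mulr_ge0 ?(ltW mu0) ?(ltW K0).
have W0 : 0 <= W := divr_ge0 E0 (mulr_ge0 (sqr_ge0 mu) (sqr_ge0 K)).
have final (x y z : R) : x <= 8 * X + Y + W -> y <= 136 * l * Y ->
    z <= 12 * 68 ^+ 2 * l ^+ 2 * W -> x + y + z <= (12 * 68 ^+ 2 + 8) * l ^+ 2 * (X + Y + W).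
  have hX := ler_wpM2r X0 l2; have hY := ler_wpM2r Y0 l2.
  have hW := ler_wpM2r W0 l2; have hY' := ler_wpM2r Y0 ll2.
  have c0 : 136 <= 12 * 68 ^+ 2 :> R by rewrite expr2; lra.
  have cX := ler_wpM2r (mulr_ge0 (sqr_ge0 l) X0) c0.
  have cY := ler_wpM2r (mulr_ge0 (sqr_ge0 l) Y0) c0.
  move: c0 cX cY hX hY hW hY'; move: (12 * 68 ^+ 2) => c2 c0.
  move: (l ^+ 2) => l_2 *; lra.
have div_le (x y : R) : 0 <= x -> 1 <= y -> x / y <= x.
  move=> x0 y1; rewrite ler_pdivrMr ?(lt_le_trans _ y1)//.
  by rewrite ler_peMr.
have pref (y m : R) : 0 <= y -> 0 <= m -> y / ((K + 1) * expR m) <= y * expR (- m).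
  move=> y0 m0; rewrite expRN invfM mulrA ler_pM2r ?invr_gt0 ?expR_gt0//.
  by apply: div_le => //; lra.
have m4 : 0 < 4 * a by rewrite mulr_gt0.
(* [68 = 4 * 17]: at the stepsize [Lam / (mu * K)] the exponent [gamma * mu / 2 * K / 2] is
   [17 * l], as in the tail hypothesis. *)
pose Lam := 68 * l.
have Lam0 : 0 < Lam by rewrite mulr_gt0.
have muK : 0 < mu * K by rewrite mulr_gt0.
have YE (g : R) : g <= Lam / (mu * K) -> 2 * g * D <= 136 * l * Y.
  move=> gL; rewrite /Y mulrA (_ : 136 * l * D / (mu * K) = 2 * (Lam / (mu * K)) * D).
    by rewrite ler_wpM2r// ler_pM2l.
  by rewrite /Lam; field; rewrite !gt_eqF.
have WE (g : R) : 0 <= g -> g <= Lam / (mu * K) ->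
    12 * E * g ^+ 2 <= 12 * 68 ^+ 2 * l ^+ 2 * W.
  move=> g0 gL; rewrite (_ : 12 * 68 ^+ 2 * l ^+ 2 * W = 12 * E * (Lam / (mu * K)) ^+ 2).
    rewrite ler_wpM2l ?mulr_ge0// ler_pXn2r// nnegrE// divr_ge0// ?(ltW Lam0)//.
    exact: ltW.
  by rewrite /W /Lam; field; rewrite !gt_eqF.
have mina : 0 < mu / a by rewrite divr_gt0.
have XE (m : R) : 1 / 16 * Num.min (mu / a) rho * K <= m ->
    8 * a * T * expR (- m) <= 8 * X.
  move=> hm; rewrite /X -!mulrA ler_pM2l// ler_pM2l// ler_wpM2l//.
  by rewrite ler_expR lerN2 !mulrA.
have big : (D = 0 /\ E = 0) \/ 1 / (4 * a) <= Lam / (mu * K) ->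
  exists gamma, [/\ 0 < gamma, gamma <= 1 / (4 * a) &
    2 / gamma * T / ((K + 1) * expR (Num.min (gamma * mu / 2) (rho / 4) * K / 2))
      + 2 * gamma * D + 12 * E * gamma ^+ 2 <= (12 * 68 ^+ 2 + 8) * l ^+ 2 * (X + Y + W)].
  move=> h; have g0 : 0 < 1 / (4 * a) by rewrite divr_gt0.
  exists (1 / (4 * a)); split => //; apply: final.
  - apply: (@le_trans _ _ (8 * X)); last by lra.
    set m := _ * K / 2.
    (* At [gamma = 1 / (4 * a)] the two candidates for the exponent are [mu / (16 * a) * K] and
       [rho / 8 * K]; hence the constant [1 / 16]. *)
    have hm : 1 / 16 * Num.min (mu / a) rho * K <= m.
      have -> : 1 / 16 * Num.min (mu / a) rho * K =
        K / 2 * (1 / 8 * Num.min (mu / a) rho) by field.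
      rewrite /m -[leRHS]mulrA [leRHS]mulrC.
      rewrite ler_pM2l ?divr_gt0// le_min.
      have [h1 h2] : Num.min (mu / a) rho <= mu / a /\ Num.min (mu / a) rho <= rho.
        by rewrite !ge_min !lexx orbT.
      apply/andP; split; last by lra.
      by rewrite (_ : 1 / (4 * a) * mu / 2 = 1 / 8 * (mu / a)) ?ler_pM2l//; field; rewrite gt_eqF.
    have m0 : 0 <= m.
      by apply: le_trans hm; rewrite !mulr_ge0 ?le_min ?(ltW mina) ?(ltW r0) ?(ltW K0).
    apply: le_trans (pref _ _ _ m0) _.
      by rewrite mulr_ge0// divr_ge0// ltW.
    rewrite (_ : 2 / (1 / (4 * a)) = 8 * a); last by field; rewrite gt_eqF.
    exact: XE.
  - case: h => [[-> _]|h]; last exact: YE.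
    by rewrite mulr0; exact: mulr_ge0 (mulr_ge0 (ler0n R 136) (ltW l0)) Y0.
  - case: h => [[_ ->]|h]; last by apply: WE => //; exact: ltW.
    rewrite mulr0 mul0r.
    exact: mulr_ge0 (mulr_ge0 (mulr_ge0 (ler0n R 12) (sqr_ge0 68)) (sqr_ge0 l)) W0.
case: tail => [DE|tail]; first by apply: big; left.
have [h|h] := leP (1 / (4 * a)) (Lam / (mu * K)); first by apply: big; right.
have g0 : 0 < Lam / (mu * K) by rewrite divr_gt0.
exists (Lam / (mu * K)); split; [by []|exact: ltW|apply: final; last first].
- by apply: WE => //; exact: ltW.
- exact: YE.
set m := _ * K / 2.
have mE : m = Num.min (17 * l) (rho * K / 8).
  have K2 : 0 <= K / 2 by rewrite divr_ge0// ltW.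
  rewrite /m -mulrA mulrC minr_pMr// /Lam; congr (Num.min _ _); last by field.
  by field; rewrite !gt_eqF.
have m0 : 0 <= m by rewrite mE le_min !mulr_ge0 ?(ltW l0) ?(ltW r0) ?(ltW K0)//.
have c0 : 0 <= 2 / (Lam / (mu * K)) * T.
  by rewrite mulr_ge0// divr_ge0// ltW.
have c1 : 2 / (Lam / (mu * K)) * T / ((K + 1) * expR m) <= 2 * mu * T * expR (- m).
  rewrite expRN [((K + 1) * _)^-1]invfM mulrA ler_pM2r ?invr_gt0 ?expR_gt0//.
  rewrite ler_pdivrMr; last by lra.
  rewrite (_ : 2 / (Lam / (mu * K)) * T = 2 * mu * T * (K / Lam)); last first.
    by field; rewrite !gt_eqF.
  rewrite ler_wpM2l ?mulr_ge0 ?(ltW mu0)//.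
  apply: (@le_trans _ _ K); last by lra.
  by apply: div_le; [exact: ltW|rewrite /Lam; lra].
apply: le_trans c1 _; rewrite mE.
have [hl|hl] := leP (17 * l) (rho * K / 8).
  by apply: le_trans tail _; rewrite -/Y -/W; lra.
apply: (@le_trans _ _ (8 * X)); last by lra.
(* The exponent is now governed by [rho]; [mu <= 4 * a] turns the prefactor [2 * mu] into
   [8 * a]. *)
apply: le_trans (XE (rho * K / 8) _).
  by rewrite ler_wpM2r ?expR_ge0// ler_wpM2r//; lra.
have h2 : Num.min (mu / a) rho <= rho by rewrite ge_min lexx orbT.
have := ler_wpM2r (ltW K0) h2; have : 0 <= rho * K by rewrite mulr_ge0 ?ltW.
lra.
Qed.

End StronglyConvexStepsize.

(** * Size of the parameters in terms of their logarithms *)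

Section LogSize.
Context {R : realType}.
Implicit Types (q : R) (qs : seq R).

(** The lower bound exempts zero, whose logarithm contributes nothing to [log_size]. *)
Definition within (X q : R) : Prop := q <= X /\ (0 < q -> X^-1 <= q).

Lemma log_size_ge1 K qs : (0 < K)%N -> 1 <= log_size K qs.
Proof.
move=> K0; rewrite /log_size -addrA lerDl addr_ge0//.
  by rewrite ln_ge0// ler1n.
by apply: sumr_ge0.
Qed.

Lemma ln_le_log_size K qs q : (0 < K)%N -> q \in qs -> `|ln q| <= log_size K qs.
Proof.
move=> K0 qin; have h : `|ln q| <= \sum_(q <- qs) `|ln q|.
  by rewrite (big_rem q)//= lerDl sumr_ge0.
by rewrite (le_trans h)// /log_size lerDr addr_ge0// ln_ge0// ler1n.
Qed.

Lemma within_log_size K qs q : (0 < K)%N -> 0 <= q -> q \in qs ->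
  within (expR (log_size K qs)) q.
Proof.
move=> K0 q0 qin; have := ln_le_log_size K0 qin; rewrite ler_norml => /andP[h1 h2].
have [->|qn0] := eqVneq q 0; first by split; [exact: expR_ge0|rewrite ltxx].
have {}q0 : 0 < q by rewrite lt_def qn0.
have qE : expR (ln q) = q by rewrite lnK// posrE.
by split => [|_]; rewrite -?expRN -{1}qE ler_expR.
Qed.

Lemma nat_le_log_size K qs : (0 < K)%N -> K%:R <= expR (log_size K qs).
Proof.
move=> K0; rewrite -[leLHS]lnK ?posrE ?ltr0n// ler_expR.
by rewrite /log_size -addrA addrCA lerDl addr_ge0// sumr_ge0.
Qed.

(* With [X] the exponential of the size of the logarithms, every parameter is at
   most [X] and every nonzero one at least [X^-1]; both sides are compared with
   [X^-7]. *)
Lemma tail_bound (X mu rho K A B C D1 D2 L Delta r S : R) :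
  let F := 4 * B / (3 * rho) in let a := A + C * F in
  let T := r ^+ 2 + F / (16 * a ^+ 2) * S in
  let D := D1 + F * D2 in let E := L * Delta ^+ 2 in
  2 <= X -> 0 < mu -> 0 < rho -> rho <= 1 -> 0 < K -> K <= X ->
  0 <= A -> 0 <= B -> 0 <= C -> 0 <= D1 -> 0 <= D2 -> 0 <= L -> 0 <= Delta ->
  0 <= r -> 0 <= S -> 0 < a ->
  within X mu -> within X rho -> within X A -> within X B -> within X C ->
  within X D1 -> within X D2 -> within X L -> within X Delta -> within X r ->
  within X S ->
  (D = 0 /\ E = 0) \/ 2 * mu * T * X^-1 ^+ 17 <=
    D / (mu * K) + E / (mu ^+ 2 * K ^+ 2).
Proof.
move=> F a T D E X2 mu0 r0 rho1 K0 KX A0 B0 C0 D10 D20 L0 De0 rr0 S0 a0.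
move=> [muX _] [_ /(_ r0) rhoX] [_ AX] [BX Bx] [_ CX] [_ D1X] [_ D2X].
move=> [_ LX] [_ DeX] [rX _] [SX _].
have X0 : 0 < X by apply: lt_le_trans X2.
set y := X^-1 in rhoX AX Bx CX D1X D2X LX DeX *.
have y0 : 0 < y by rewrite invr_gt0.
have yX : X * y = 1 by rewrite divff ?gt_eqF.
have y1 : y <= 1 by rewrite invf_le1//; lra.
have X1 : 1 <= X by lra.
have F0 : 0 <= F by rewrite divr_ge0 ?mulr_ge0 ?(ltW r0).
have FB : B <= F.
  by rewrite /F ler_pdivlMr ?mulr_gt0//; have := ler_wpM2l B0 rho1; lra.
have FX : F <= 4 / 3 * X ^+ 2.
  rewrite /F ler_pdivrMr ?mulr_gt0//.
  have := ler_wpM2l (ltW (exprn_gt0 2 X0)) rhoX.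
  by rewrite expr2 -mulrA yX mulr1 => h; nra.
have pow m p : (m <= p)%N -> y ^+ p <= y ^+ m.
  by move=> mp; rewrite ler_wiXn2l ?(ltW y0).
have Xpow m p : (m <= p)%N -> X ^+ m <= X ^+ p by move=> mp; rewrite ler_weXn2l.
have prod (u v : R) m p : y ^+ m <= u -> y ^+ p <= v -> y ^+ (m + p) <= u * v.
  by move=> hu hv; rewrite exprD ler_pM ?exprn_ge0 ?(ltW y0).
have Xprod (u v : R) m p : 0 <= u -> 0 <= v -> u <= X ^+ m -> v <= X ^+ p ->
    u * v <= X ^+ (m + p).
  by move=> u0 v0 hu hv; rewrite exprD ler_pM.
(* Since [a] is positive, either [A] is nonzero, or both [C] and [B] are, and then [F >= B] because
   [rho <= 1]. *)
have ay : y ^+ 2 <= a.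
  have [A_0|A_n0] := eqVneq A 0.
    have CF0 : 0 < C * F by move: a0; rewrite /a A_0 add0r.
    have Cn0 : 0 < C by rewrite lt_def C0 andbT; apply: contraTneq CF0 => ->; rewrite mul0r ltxx.
    have Fn0 : 0 < F by rewrite lt_def F0 andbT; apply: contraTneq CF0 => ->; rewrite mulr0 ltxx.
    have Bn0 : 0 < B.
      by rewrite lt_def B0 andbT; apply: contraTneq Fn0 => B_0; rewrite /F B_0 mulr0 mul0r ltxx.
    rewrite /a A_0 add0r (_ : 2 = 1 + 1)%N//; apply: prod; rewrite expr1; first exact: CX.
    exact: le_trans (Bx Bn0) FB.
  have An0 : 0 < A by rewrite lt_def A_n0.
  apply: (@le_trans _ _ y); first by rewrite -[leRHS]expr1 pow.
  by apply: le_trans (AX An0) _; rewrite lerDl mulr_ge0.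
have ia : a^-1 <= X ^+ 2.
  rewrite -[X ^+ 2]invrK lef_pV2 ?posrE ?invr_gt0 ?exprn_gt0//.
  by rewrite -exprVn.
have ia0 : 0 <= a^-1 by rewrite invr_ge0 ltW.
have TX : T <= X ^+ 8.
  have h1 : F / (16 * a ^+ 2) * S <= X ^+ 7.
    have -> : F / (16 * a ^+ 2) * S = F / 16 * (S * (a^-1 * a^-1)).
      by field; rewrite gt_eqF.
    apply: (Xprod _ _ 2 5).
    - by rewrite divr_ge0.
    - by rewrite !mulr_ge0.
    - by have := exprn_gt0 2 X0; lra.
    - apply: (Xprod _ _ 1 4); rewrite ?expr1 ?mulr_ge0//.
      exact: (Xprod _ _ 2 2).
  have h2 : r ^+ 2 <= X ^+ 7.
    by apply: le_trans (Xpow 2 7 isT); rewrite ler_pXn2r ?nnegrE ?(ltW X0).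
  rewrite exprSr; have := ler_wpM2l (ltW (exprn_gt0 7 X0)) X2.
  by rewrite /T; lra.
have T0 : 0 <= T.
  by rewrite addr_ge0 ?sqr_ge0// mulr_ge0// divr_ge0// mulr_ge0// sqr_ge0.
(* [17 = 10 + 7]: [2 * mu * T] is at most [X ^+ 10], while the right side of the claim is at least
   [y ^+ 4] if [D] is nonzero and [y ^+ 7] if [E] is. *)
have lhs : 2 * mu * T * y ^+ 17 <= y ^+ 7.
  have h : 2 * mu * T <= X ^+ 10.
    apply: (Xprod _ _ 2 8) => //; first by rewrite mulr_ge0// ltW.
    by rewrite expr2 ler_pM// ltW.
  apply: (@le_trans _ _ (X ^+ 10 * y ^+ 17)).
    by rewrite ler_wpM2r// exprn_ge0// ltW.
  by rewrite (exprD y 10 7) mulrA -exprMn yX expr1n mul1r.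
have muK : y ^+ 2 <= (mu * K)^-1.
  rewrite exprVn lef_pV2 ?posrE ?mulr_gt0 ?exprn_gt0//.
  by rewrite expr2 ler_pM// ltW.
have D0 : 0 <= D by rewrite addr_ge0// mulr_ge0.
have E0 : 0 <= E by rewrite mulr_ge0// sqr_ge0.
have muK0 : 0 <= (mu * K)^-1 by rewrite invr_ge0 mulr_ge0// ltW.
have E2 : E / (mu ^+ 2 * K ^+ 2) = E * ((mu * K)^-1 * (mu * K)^-1).
  by rewrite -exprMn expr2 invfM.
have DD0 : 0 <= D / (mu * K) by rewrite mulr_ge0.
have EE0 : 0 <= E / (mu ^+ 2 * K ^+ 2) by rewrite E2 !mulr_ge0.
have [D_0|Dn0] := eqVneq D 0; last first.
  right; apply: le_trans lhs _; apply: (@le_trans _ _ (D / (mu * K))); last by rewrite lerDl.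
  apply: le_trans (pow 4 7 isT) _; apply: (prod _ _ 2 2) => //.
  have [D1_0|D1n0] := eqVneq D1 0.
    have FD : 0 < F * D2 by move: Dn0; rewrite /D D1_0 add0r lt_def => ->; rewrite mulr_ge0.
    have D2n0 : 0 < D2 by rewrite lt_def D20 andbT; apply: contraTneq FD => ->; rewrite mulr0 ltxx.
    have Fn0 : 0 < F by rewrite lt_def F0 andbT; apply: contraTneq FD => ->; rewrite mul0r ltxx.
    have Bn0 : 0 < B.
      by rewrite lt_def B0 andbT; apply: contraTneq Fn0 => B_0; rewrite /F B_0 mulr0 mul0r ltxx.
    rewrite /D D1_0 add0r; apply: (prod _ _ 1 1); rewrite expr1; last exact: D2X.
    exact: le_trans (Bx Bn0) FB.
  have D1p : 0 < D1 by rewrite lt_def D1n0.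
  apply: (@le_trans _ _ y); first by rewrite -[leRHS]expr1 pow.
  by apply: le_trans (D1X D1p) _; rewrite lerDl mulr_ge0.
have [E_0|En0] := eqVneq E 0; first by left.
right; apply: le_trans lhs _.
apply: (@le_trans _ _ (E / (mu ^+ 2 * K ^+ 2))); last by rewrite lerDr.
have Ln0 : 0 < L by rewrite lt_def L0 andbT; apply: contraNneq En0 => L_0; rewrite /E L_0 mul0r.
have Den0 : 0 < Delta.
  by rewrite lt_def De0 andbT; apply: contraNneq En0 => L_0; rewrite /E L_0 expr0n mulr0.
rewrite E2; apply: (prod _ _ 3 4); last exact: (prod _ _ 2 2).
apply: (prod _ _ 1 2); first by rewrite expr1 LX.
by rewrite ler_pXn2r ?nnegrE ?(ltW y0)// DeX.
Qed.

End LogSize.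

(** * The rates in both regimes *)

Lemma average_differentiable (R : realType) (d n : nat)
    (fs : 'I_n -> 'rV[R]_d -> R) y :
  (forall i x, differentiable (fs i) x) -> differentiable (average fs) y.
Proof.
move=> dfs.
have -> : average fs = n%:R^-1 *: (\sum_(i < n) fs i).
  by apply/funext => x; rewrite /average fctE fct_sumE.
by apply: differentiableZ; apply: differentiable_sum => i; exact: dfs.
Qed.

(* [c], [c'] and [p] are the absolute constants of the order notation: a factor,
   a factor in the exponent, and the degree in the logarithms.  For [mu = 0] and
   [x0 = xs] the right-hand side would be zero, although noise moves the iterates
   off the minimizer for every positive stepsize: hence [x0 != xs] there. *)
Theorem corollary2p3 (R : realType) :
  exists (c c' : R) (p : nat), 0 < c /\ 0 < c' /\
  forall (d n : nat) (fs : 'I_n -> 'rV[R]_d -> R) (x0 xs : 'rV[R]_d)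
    (mu L Delta A B C D1 D2 rho : R)
    (dO dZ : measure_display)
    (Omega : measurableType dO) (P : probability Omega R)
    (Z : measurableType dZ) (Q : probability Z R)
    (comp : 'rV[R]_d -> Z -> 'rV[R]_d)
    (seed : nat -> 'I_n -> Omega -> Z)
    (oracle : nat -> 'I_n -> seq 'rV[R]_d -> Omega -> 'rV[R]_d)
    (Past Mid : nat -> set (set Omega))
    (sigma2 : R -> nat -> Omega -> R) (sigma20 : Omega -> R),
  let f := average fs in
  let F := 4 * B / (3 * rho) in
  let a := A + C * F in
  let R0 := enorm (x0 - xs) in
  let T0 := fun w => R0 ^+ 2 + F / (16 * a ^+ 2) * sigma20 w in
  (0 < n)%N ->
  (forall i x, differentiable (fs i) x) ->
  unique_minimizer f xs ->
  @convex_function R 'rV[R]_d setT f ->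
  0 <= mu -> quasi_strongly_convex mu xs f ->
  0 <= L -> smooth L f ->
  0 <= Delta -> absolute_compressor Q comp Delta ->
  0 <= A -> 0 <= B -> 0 <= C -> 0 <= D1 -> 0 <= D2 ->
  0 < rho -> rho <= 1 ->
  0 < a ->
  information Past Mid ->
  (forall k i, fresh_seed P Q (Mid k) (seed k i)) ->
  (forall k i S, measurable S -> Past k.+1 (seed k i @^-1` S)) ->
  (forall gamma : R, 0 < gamma ->
    [/\ forall k i, measurable_wrt (Mid k)
                      (sgrad oracle comp seed x0 gamma k i),
        sigma2 gamma 0%N = sigma20 &
        key_assumption oracle comp seed x0 gamma P Past f xs
          A B C D1 D2 rho (sigma2 gamma)]) ->
  forall K : nat, (0 < K)%N ->
  exists gamma : R,
  let eta := Num.min (gamma * mu / 2) (rho / 4) in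
  let xbar := weighted_iterate oracle comp seed x0 gamma eta K in
  let gap := 'E_P[(fun w => (f (xbar w) - f xs)%R)]%E in
  let logs := log_size K [:: mu; L; Delta; A; B; C; D1; D2; rho; R0;
                             fine 'E_P[sigma20]%E] in
  [/\ 0 < gamma, gamma <= 1 / (4 * a),
      0 < mu ->
        (gap <= (c * logs ^+ p)%:E *
          (a%:E * 'E_P[T0]
             * (expR (- (c' * Num.min (mu / a) rho * K%:R)))%:E
           + ((D1 + F * D2) / (mu * K%:R))%:E
           + (L * Delta ^+ 2 / (mu ^+ 2 * K%:R ^+ 2))%:E))%E &
      mu = 0 -> x0 != xs ->
        (gap <= c%:E *
          ((a * R0 ^+ 2 / K%:R)%:E
           + (R0 / (K%:R * Num.sqrt rho))%:E * sqrte (B%:E * 'E_P[sigma20])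
           + (Num.sqrt (R0 ^+ 2 * (D1 + F * D2) / K%:R))%:E
           + (L `^ (1 / 3) * R0 `^ (4 / 3) * Delta `^ (2 / 3)
                / K%:R `^ (2 / 3))%:E))%E].
Proof.
(* The constants come from the case [mu > 0], where the compression term at stepsize
   [68 * l / (mu * K)] produces [12 * 68 ^+ 2 * l ^+ 2]; the case [mu = 0] needs only 14. *)
exists (12 * 68 ^+ 2 + 8), (1 / 16), 2%N.
have c0 : 0 < 12 * 68 ^+ 2 + 8 :> R by rewrite addr_gt0 ?mulr_gt0 ?exprn_gt0.
split => //; split; first by rewrite divr_gt0.
move=> d n fs x0 xs mu L Delta A B C D1 D2 rho dO dZ Omega P Z Q comp seed
  oracle Past Mid sigma2 sigma20 f F a R0 T0 n0 dfs xs_min cf mu0 fmu L0 fL De0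
  hC A0 B0 C0 D10 D20 r0 rho1 a0 hI hfresh hseed hrun K K0.
have F0 : 0 <= F by rewrite divr_ge0 ?mulr_ge0 ?(ltW r0).
have BF : B = 3 / 4 * rho * F by rewrite /F; field; rewrite gt_eqF.
have df y : differentiable f y by exact: average_differentiable.
have [[ms20 s20] hkey1] : (measurable_wrt (Past 0) sigma20 /\ forall w, 0 <= sigma20 w) /\
    forall g, 0 < g -> sigma2 g 0%N = sigma20.
  split; last by move=> g /hrun[].
  by have [_ <- /(_ 0%N)[]] := hrun 1 ltr01.
have [[_ PM] _ _ _] := hI 0%N.
have ms := measurable_wrt_fun PM ms20.
have Kr : 0 < K%:R :> R by rewrite ltr0n.
set qs := [:: mu; L; Delta; A; B; C; D1; D2; rho; R0; fine 'E_P[sigma20]%E].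
have l1 := log_size_ge1 qs K0; set l := log_size K qs in l1 *.
have cl : 0 < (12 * 68 ^+ 2 + 8) * l ^+ 2.
  by rewrite mulr_gt0// exprn_gt0// (lt_le_trans ltr01).
have ga0 : 0 < 1 / (4 * a) by rewrite divr_gt0 ?mulr_gt0.
have D0 : 0 <= D1 + F * D2 by rewrite addr_ge0// mulr_ge0.
have R00 : 0 <= R0 by exact: enorm_ge0.
have Es20 : ('E_P[sigma20] = \int[P]_w (sigma20 w)%:E)%E by rewrite unlock.
have Es0 : (0 <= 'E_P[sigma20])%E by exact: expectation_ge0.
(* In this case both right-hand sides are infinite, so any admissible stepsize will do. *)
have [inf|] := pselect (0 < B /\ ('E_P[sigma20] = +oo)%E).
  case: inf => B_gt0 Einf; exists (1 / (4 * a)); split => //.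
    move=> mu_gt0; have F_gt0 : 0 < F by apply: divr_gt0; apply: mulr_gt0.
    have k0 : 0 < F / (16 * a ^+ 2).
      by apply: divr_gt0 => //; apply: mulr_gt0 => //; exact: exprn_gt0.
    have -> : 'E_P[T0]%E = +oo%E.
      apply/eqP; rewrite -leye_eq unlock -(gt0_muley (x := (F / (16 * a ^+ 2))%:E)) ?lte_fin//.
      rewrite -Einf Es20 -ge0_integralZl_EFin//; last 3 first.
      - by move=> w _; rewrite lee_fin.
      - exact/measurable_EFinP.
      - exact: ltW.
      apply: ge0_le_integral => //.
      - by move=> w _; rewrite mule_ge0// lee_fin ?(ltW k0).
      - by apply/measurable_EFinP; apply: measurable_funM.
      - apply/measurable_EFinP; apply: measurable_funD => //.
        by apply: measurable_funM.
      - by move=> w _; rewrite -EFinM lee_fin lerDr sqr_ge0.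
    rewrite gt0_muley ?lte_fin// gt0_mulye ?lte_fin ?expR_gt0// !addye//.
    by rewrite gt0_muley ?lte_fin// leey.
  (* A zero [R0] would annihilate the infinite factor, the product of 0 and [+oo] being 0. *)
  move=> _ x0xs; have R_gt0 : 0 < R0.
    rewrite lt_def R00 andbT; apply: contraNneq x0xs => /enorm_eq0/eqP.
    by rewrite subr_eq0.
  rewrite Einf gt0_muley ?lte_fin// [sqrte _]/= gt0_muley; last first.
    by rewrite lte_fin divr_gt0// mulr_gt0// sqrtr_gt0.
  by rewrite addey// !addye// gt0_muley ?lte_fin// leey.
move=> fincase.
(* [fine] sends an infinite mean to 0; this can now happen only when [B = 0], and then [S] is
   multiplied by [F = 0]. *)
pose S := fine 'E_P[sigma20]%E; pose s0 := F * S.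
have S0 : 0 <= S by exact: fine_ge0.
have hS : B != 0 -> intg P sigma20 /\ mean P sigma20 = S.
  move=> Bn0; have Elt : ('E_P[sigma20] < +oo)%E.
    rewrite ltey; apply/eqP => Einf; apply: fincase; split => //.
    by rewrite lt_def Bn0.
  rewrite /S Es20; split => //; apply: ge0_intg => //; by rewrite -Es20.
have hF : has_mean P (fun w => F * sigma20 w) s0.
  have [B_0|Bn0] := eqVneq B 0.
    rewrite /s0 /F B_0 mulr0 mul0r mul0r.
    by apply: eq_has_mean (has_mean_cst P 0) => w; rewrite mul0r.
  by have [iS mS] := hS Bn0; rewrite /s0 -mS; exact: has_meanZ.
have iF := hF.1.
have BE : (B%:E * 'E_P[sigma20] = (B * S)%:E)%E.
  have [B_0|Bn0] := eqVneq B 0; first by rewrite B_0 mul0e mul0r.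
  have [iS mS] := hS Bn0.
  by rewrite Es20 EFin_mean// mS.
pose T := R0 ^+ 2 + F / (16 * a ^+ 2) * S.
have TE : 'E_P[T0]%E = T%:E.
  rewrite unlock; have [iT mT] : has_mean P T0 T; last by rewrite EFin_mean// mT.
  apply: has_meanD (has_mean_cst P _) _.
  have -> : F / (16 * a ^+ 2) * S = (16 * a ^+ 2)^-1 * s0 by rewrite /s0 (mulrA _ F S) (mulrC F).
  apply: eq_has_mean (has_meanZ (16 * a ^+ 2)^-1 hF) => w /=.
  by rewrite (mulrA _ F) (mulrC F).
pose xbar g := weighted_iterate oracle comp seed x0 g (Num.min (g * mu / 2) (rho / 4)) K.
have gapE g (g0 : 0 < g) : g <= 1 / (4 * a) ->
    ('E_P[(fun w => f (xbar g w) - f xs)%R] <=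
      (2 / g * (R0 ^+ 2 + g ^+ 2 * s0)
       / (K.+1%:R * expR (Num.min (g * mu / 2) (rho / 4) * K%:R / 2))
       + 2 * g * (D1 + F * D2) + 12 * L * g ^+ 2 * Delta ^+ 2)%:E)%E.
  move=> ga; have [mg sg hkey] := hrun g g0.
  have iFg : intg P (fun w => F * sigma2 g 0%N w) by rewrite sg.
  have [|||i le] := weighted_gap_bound df cf xs_min mu0 fmu L0 fL n0 hC hI hfresh
    hseed g0 mg rho1 F0 BF hkey iFg (eta := Num.min (g * mu / 2) (rho / 4)) K ga a0.
  - by rewrite le_min !divr_ge0 ?mulr_ge0 ?(ltW g0) ?(ltW r0).
  - by rewrite ge_min lexx.
  - by rewrite ge_min lexx orbT.
  rewrite unlock EFin_mean// lee_fin (le_trans le)//.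
  by rewrite /mean_noise sg hF.2.
have [mu_0|mun0] := eqVneq mu 0.
  have [x0xs|x0xs] := eqVneq x0 xs.
    exists (1 / (4 * a)); split => //; first by rewrite mu_0 ltxx.
  have R_gt0 : 0 < R0.
    rewrite lt_def R00 andbT; apply: contraNneq x0xs => /enorm_eq0/eqP.
    by rewrite subr_eq0.
  pose B2 := Num.sqrt (B * S) / Num.sqrt rho.
  have B20 : 0 <= B2 by rewrite divr_ge0.
  have s00 : 0 <= s0 by rewrite mulr_ge0.
  have sB : s0 <= 4 * B2 ^+ 2.
    rewrite expr_div_n !sqr_sqrtr ?mulr_ge0 ?(ltW r0)// /s0 /F.
    rewrite -subr_ge0 (_ : _ - _ = 8 / 3 * (B * S / rho)); last by field; rewrite gt_eqF.
    by rewrite mulr_ge0// divr_ge0 ?mulr_ge0 ?(ltW r0).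
  have [g [g0 ga le]] := convex_stepsize a0 R_gt0 Kr s00 D0 L0 De0 B20 sB.
  exists g; split => //; first by rewrite mu_0 ltxx.
  move=> _ _; apply: le_trans (gapE g g0 ga) _.
  rewrite BE [sqrte _]/= -!EFinM lee_fin.
  rewrite mu_0 mulr0 mul0r min_l ?divr_ge0 ?(ltW r0)// !mul0r expR0 mulr1.
  have rB : R0 / (K%:R * Num.sqrt rho) * Num.sqrt (B * S) = R0 / K%:R * B2.
    by rewrite /B2 invfM; ring.
  rewrite rB; apply: le_trans (le_trans _ le) _.
    rewrite !lerD2r ler_wpM2l ?lef_pV2 ?posrE ?ltr0n ?ler_nat//.
    exact: mulr_ge0 (divr_ge0 (ler0n R 2) (ltW g0))
      (addr_ge0 (sqr_ge0 R0) (mulr_ge0 (sqr_ge0 g) s00)).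
  rewrite ler_wpM2r//; last first.
    by rewrite expr2; lra.
  apply: addr_ge0; [apply: addr_ge0; [apply: addr_ge0|exact: sqrtr_ge0]|].
  - exact: divr_ge0 (mulr_ge0 (ltW a0) (sqr_ge0 R0)) (ltW Kr).
  - exact: mulr_ge0 (divr_ge0 R00 (ltW Kr)) B20.
  - by apply: divr_ge0; rewrite ?powR_ge0// !mulr_ge0 ?powR_ge0.
have mu_gt0 : 0 < mu by rewrite lt_def mun0.
have T_0 : 0 <= T.
  rewrite /T; apply: addr_ge0 (sqr_ge0 _) (mulr_ge0 (divr_ge0 F0 _) S0).
  exact: mulr_ge0 (ler0n R 16) (sqr_ge0 a).
have E0 : 0 <= L * Delta ^+ 2 by rewrite mulr_ge0// sqr_ge0.
have [Amu|Amu] := leP (4 * A) mu.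
  exists (1 / (4 * a)); split => //; last by move=> mu_0; rewrite mu_0 eqxx in mun0.
  move=> _; rewrite TE -!EFinM.
  apply: (@le_trans _ _ 0%:E).
    rewrite unlock; apply: (large_curvature_gap df cf xs_min mu_gt0 fmu L0 fL n0 hC
      hI hfresh hseed A0 C0 D10 D20 r0 rho1 F0 BF hrun iF Amu) => //.
    have r4 : rho / 4 < 1 by rewrite ltr_pdivrMr// mul1r (le_lt_trans rho1)// ltr1n.
    by rewrite gt_min r4 orbT.
  rewrite lee_fin; apply: mulr_ge0 (ltW cl) _; apply: addr_ge0; first apply: addr_ge0.
  - exact: mulr_ge0 (mulr_ge0 (ltW a0) T_0) (expR_ge0 _).
  - exact: divr_ge0 D0 (mulr_ge0 mu0 (ltW Kr)).
  - exact: divr_ge0 E0 (mulr_ge0 (sqr_ge0 mu) (sqr_ge0 _)).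
have mua : mu <= 4 * a.
  by apply: le_trans (ltW Amu) _; rewrite ler_pM2l// lerDl mulr_ge0.
have K1 : 1 <= K%:R :> R by rewrite ler1n.
have X2 : 2 <= expR l by apply: le_trans (expR_ge1Dx _); move: l1; clear; lra.
have W q : 0 <= q -> q \in qs -> within (expR l) q by exact: within_log_size.
have Wmu : within (expR l) mu by apply: W; rewrite // !inE eqxx ?orbT.
have WL : within (expR l) L by apply: W; rewrite // !inE eqxx ?orbT.
have WDe : within (expR l) Delta by apply: W; rewrite // !inE eqxx ?orbT.
have WA : within (expR l) A by apply: W; rewrite // !inE eqxx ?orbT.
have WB : within (expR l) B by apply: W; rewrite // !inE eqxx ?orbT.
have WC : within (expR l) C by apply: W; rewrite // !inE eqxx ?orbT.
have WD1 : within (expR l) D1 by apply: W; rewrite // !inE eqxx ?orbT.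
have WD2 : within (expR l) D2 by apply: W; rewrite // !inE eqxx ?orbT.
have Wr : within (expR l) rho by apply: W; [exact: ltW|rewrite !inE eqxx ?orbT].
have WR : within (expR l) R0 by apply: W; rewrite // !inE eqxx ?orbT.
have WS : within (expR l) S by apply: W; rewrite // !inE eqxx ?orbT.
have := tail_bound X2 mu_gt0 r0 rho1 Kr (nat_le_log_size qs K0)
  A0 B0 C0 D10 D20 L0 De0 R00 S0 a0 Wmu Wr WA WB WC WD1 WD2 WL WDe WR WS.
rewrite -expRN -expRM_natl mulrN => tail.
have [g [g0 ga le]] := curved_stepsize a0 mu_gt0 mua r0 K1 T_0 D0 E0 l1 tail.
exists g; split => //; last by move=> mu_0; rewrite mu_0 eqxx in mun0.
move=> _; apply: le_trans (gapE g g0 ga) _.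
rewrite TE -!EFinM lee_fin; apply: le_trans le.
rewrite natr1 (_ : 12 * L * g ^+ 2 * Delta ^+ 2 = 12 * (L * Delta ^+ 2) * g ^+ 2);
  last by ring.
rewrite !lerD2r.
apply: ler_wpM2r; first by rewrite invr_ge0; exact: mulr_ge0 (ler0n R _) (expR_ge0 _).
apply: (ler_wpM2l (divr_ge0 (ler0n R 2) (ltW g0))); rewrite /T lerD2l /s0.
rewrite (mulrA _ F S) (mulrC F); apply: (ler_wpM2r S0); apply: (ler_wpM2r F0).
(* The largest admissible value of [gamma ^+ 2] explains the weight of [sigma20] in [T0]. *)
rewrite (_ : (16 * a ^+ 2)^-1 = (1 / (4 * a)) ^+ 2); last by field; rewrite gt_eqF.
by rewrite ler_pXn2r// nnegrE ltW.
Qed.
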